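(* Let $k$ be an algebraically closed field and let $(R,\mathfrak{m})$ be a commutative local complete Gorenstein $k$-algebra with $R/\mathfrak{m}\cong k$. Let $F'$ and $G'$ be finitely generated $R$-modules such that $F'$ is a direct summand of $G'$, and set $A=\mathrm{End}_R(R\oplus F')$ and $A'=\mathrm{End}_R(R\oplus G')$. If $A$ has finite global dimension, then there is a fully faithful triangle functor $$\Delta_R(A)\longrightarrow\Delta_R(A').$$
   Context: $\mathrm{mod}\text{-}B$ denotes finitely generated right $B$-modules. For $B=\mathrm{End}_R(R\oplus H)$ with $H$ a finitely generated $R$-module, let $e_B\in B$ be the idempotent corresponding to the identity of the summand $R$; then $e_BBe_B\cong R$ and $-\otimes^L_{e_BBe_B}e_BB$ embeds $K^b(\mathrm{proj}\text{-}R)$ fully faithfully into $D^b(\mathrm{mod}\text{-}B)$ with image $\mathrm{thick}(e_BB)$. The relative singularity category is the Verdier quotient $\Delta_R(B)=D^b(\mathrm{mod}\text{-}B)/K^b(\mathrm{proj}\text{-}R)\cong D^b(\mathrm{mod}\text{-}B)/\mathrm{thick}(e_BB)$. *)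

(* Defs.v *)
From HB Require Import structures.
From mathcomp Require Import all_boot all_order all_algebra.
From mathcomp Require Import boolp.
From mathcomp Require Import zify.

Set Implicit Arguments.
Unset Strict Implicit.
Unset Printing Implicit Defensive.

Import Order.TTheory GRing.Theory Num.Theory.
Local Open Scope ring_scope.

Definition mk_linear (S : pzRingType) (U V : lmodType S) (f : U -> V)
    (Hf : linear f) : {linear U -> V} :=
  HB.pack f (GRing.isLinear.Build S U V *:%R f Hf).

Section Modules.
Variable S : pzRingType.

Definition fin_gen (M : lmodType S) : Prop :=
  exists (n : nat) (v : 'I_n -> M),
    forall x : M, exists a : 'I_n -> S, x = \sum_(i < n) a i *: v i.

Definition exact_at (K P M : lmodType S)
    (f : {linear K -> P}) (g : {linear P -> M}) : Prop :=
  forall x : P, g x = 0 <-> exists y : K, x = f y.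

Definition short_exact (K P M : lmodType S)
    (f : {linear K -> P}) (g : {linear P -> M}) : Prop :=
  [/\ injective f, exact_at f g & forall z : M, exists x : P, z = g x].

Definition projective_module (P : lmodType S) : Prop :=
  forall (U V : lmodType S) (p : {linear U -> V}) (f : {linear P -> V}),
    (forall z : V, exists x : U, z = p x) ->
    exists g : {linear P -> U}, forall x, p (g x) = f x.

Definition injective_module (I : lmodType S) : Prop :=
  forall (U V : lmodType S) (j : {linear U -> V}) (f : {linear U -> I}),
    injective j ->
    exists g : {linear V -> I}, forall x, g (j x) = f x.

(* A projective resolution 0 -> P_n -> ... -> P_0 -> M -> 0, cut into short
   exact sequences. *)
Fixpoint projdim_le (n : nat) (M : lmodType S) : Prop :=
  match n with
  | 0%N => projective_module M
  | n'.+1 => exists (K P : lmodType S)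
               (f : {linear K -> P}) (g : {linear P -> M}),
      [/\ short_exact f g, projective_module P & projdim_le n' K]
  end.

Fixpoint injdim_le (n : nat) (M : lmodType S) : Prop :=
  match n with
  | 0%N => injective_module M
  | n'.+1 => exists (I C : lmodType S)
               (f : {linear M -> I}) (g : {linear I -> C}),
      [/\ short_exact f g, injective_module I & injdim_le n' C]
  end.

Definition direct_summand (F G : lmodType S) : Prop :=
  exists (F' : lmodType S) (phi : {linear (F * F')%type -> G}), bijective phi.

End Modules.

(* Right B-modules are left modules over the converse ring B^c. *)
Definition finite_right_gldim (B : pzRingType) : Prop :=
  exists n : nat, forall M : lmodType B^c, projdim_le n M.

Section CommutativeAlgebra.
Variable R : comPzRingType.

Definition ideal (I : {pred R}) : Prop := submod_closed (I : {pred R^o}).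

Definition noetherian : Prop :=
  forall I : {pred R}, ideal I ->
    exists (n : nat) (v : 'I_n -> R), (forall i, v i \in I) /\
      forall x, x \in I -> exists a : 'I_n -> R, x = \sum_(i < n) a i * v i.

Definition maximal_ideal (I : {pred R}) : Prop :=
  [/\ ideal I, 1 \notin I &
      forall J : {pred R}, ideal J -> 1 \notin J ->
        {subset I <= J} -> J =i I].

Definition local_ring (m : {pred R}) : Prop :=
  maximal_ideal m /\ forall I : {pred R}, maximal_ideal I -> I =i m.

Definition ideal_mul (I J : {pred R}) : {pred R} :=
  [pred x | `[< exists (n : nat) (a b : 'I_n -> R),
    (forall i, a i \in I /\ b i \in J) /\ x = \sum_(i < n) a i * b i >]].

Definition ideal_pow (I : {pred R}) (n : nat) : {pred R} :=
  iter n (ideal_mul I) predT.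

(* Bijectivity of R -> lim R/I^n; a point of the limit is represented by a
   sequence u such that u n.+1 and u n agree modulo I^n. *)
Definition adically_complete (I : {pred R}) : Prop :=
  (forall x, (forall n, x \in ideal_pow I n) -> x = 0) /\
  (forall u : nat -> R, (forall n, u n.+1 - u n \in ideal_pow I n) ->
     exists x, forall n, u n - x \in ideal_pow I n).

Definition gorenstein_local (m : {pred R}) : Prop :=
  [/\ local_ring m, noetherian & exists n, injdim_le n (R^o : lmodType R)].

End CommutativeAlgebra.

(* R/m is isomorphic to k as a k-algebra, via the first isomorphism theorem. *)
Definition residue_field_is (k : fieldType) (R : comAlgType k) (m : {pred R})
    : Prop :=
  exists pi : {lrmorphism R -> k^o},
    (forall c : k, exists r, pi r = c) /\ forall r, (r \in m) = (pi r == 0).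

Section LinearMaps.
Variable S : pzRingType.

Lemma linearfun_ext (V W : lmodType S) (f g : {linear V -> W}) :
  (forall x, f x = g x) -> f = g.
Proof.
case: f g => [f [[Hf1] [Hf2]]] [g [[Hg1] [Hg2]]] /= /funext E.
by case: _ / E in Hg1 Hg2 *; rewrite (Prop_irrelevance Hf1 Hg1)
  (Prop_irrelevance Hf2 Hg2).
Qed.

Fact id_linear_subproof (U : lmodType S) : linear (fun x : U => x).
Proof. by []. Qed.
Definition id_linear (U : lmodType S) : {linear U -> U} :=
  mk_linear (@id_linear_subproof U).

Fact comp_linear_subproof (U V W : lmodType S)
  (g : {linear V -> W}) (f : {linear U -> V}) : linear (fun x => g (f x)).
Proof. by move=> a x y; rewrite !linearP. Qed.
Definition comp_linear (U V W : lmodType S)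
  (g : {linear V -> W}) (f : {linear U -> V}) : {linear U -> W} :=
  mk_linear (comp_linear_subproof g f).

Fact add_linear_subproof (U V : lmodType S) (f g : {linear U -> V}) :
  linear (fun x => f x + g x).
Proof. by move=> a x y; rewrite !linearP scalerDr addrACA. Qed.
Definition add_linear (U V : lmodType S) (f g : {linear U -> V})
  : {linear U -> V} := mk_linear (add_linear_subproof f g).

Fact opp_linear_subproof (U V : lmodType S) (f : {linear U -> V}) :
  linear (fun x => - f x).
Proof. by move=> a x y; rewrite linearP opprD scalerN. Qed.
Definition opp_linear (U V : lmodType S) (f : {linear U -> V})
  : {linear U -> V} := mk_linear (opp_linear_subproof f).

Fact zero_linear_subproof (U V : lmodType S) : linear (fun _ : U => 0 : V).
Proof. by move=> a x y; rewrite scaler0 addr0. Qed.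
Definition zero_linear (U V : lmodType S) : {linear U -> V} :=
  mk_linear (@zero_linear_subproof U V).

End LinearMaps.

Definition endo (S : pzRingType) (U : lmodType S) := {linear U -> U}.

Section EndoRing.
Variables (S : pzRingType) (U : lmodType S).
Implicit Types f g h : endo U.

HB.instance Definition _ := gen_eqMixin (endo U).
HB.instance Definition _ := gen_choiceMixin (endo U).

Definition endo_zero : endo U := zero_linear U U.
Definition endo_opp f : endo U := opp_linear f.
Definition endo_add f g : endo U := add_linear f g.
Definition endo_one : endo U := id_linear U.
Definition endo_mul f g : endo U := comp_linear f g.

Fact endo_addA : associative endo_add.
Proof. by move=> f g h; apply: linearfun_ext => x /=; rewrite addrA. Qed.
Fact endo_addC : commutative endo_add.
Proof. by move=> f g; apply: linearfun_ext => x /=; rewrite addrC. Qed.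
Fact endo_add0 : left_id endo_zero endo_add.
Proof. by move=> f; apply: linearfun_ext => x /=; rewrite add0r. Qed.
Fact endo_addN : left_inverse endo_zero endo_opp endo_add.
Proof. by move=> f; apply: linearfun_ext => x /=; rewrite addNr. Qed.

HB.instance Definition _ := GRing.isZmodule.Build (endo U)
  endo_addA endo_addC endo_add0 endo_addN.

Fact endo_mulA : associative endo_mul.
Proof. by move=> f g h; apply: linearfun_ext. Qed.
Fact endo_mul1 : left_id endo_one endo_mul.
Proof. by move=> f; apply: linearfun_ext. Qed.
Fact endo_1mul : right_id endo_one endo_mul.
Proof. by move=> f; apply: linearfun_ext. Qed.
Fact endo_mulDl : left_distributive endo_mul +%R.
Proof. by move=> f g h; apply: linearfun_ext. Qed.
Fact endo_mulDr : right_distributive endo_mul +%R.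
Proof. by move=> f g h; apply: linearfun_ext => x /=; rewrite linearD. Qed.

HB.instance Definition _ := GRing.Zmodule_isPzRing.Build (endo U)
  endo_mulA endo_mul1 endo_1mul endo_mulDl endo_mulDr.

End EndoRing.

(* (B^c)^o is B as a right module over itself. *)
Section RightIdeal.
Variables (B : pzRingType) (e : B).

Definition right_ideal_pred : {pred (B^c)^o} :=
  [pred x | `[< exists b : B, x = e * b :> B >]].

Fact right_ideal_submod_closed : submod_closed right_ideal_pred.
Proof.
split; first by apply/asboolP; exists 0; rewrite mulr0.
move=> a x y /asboolP[b bE] /asboolP[c cE]; apply/asboolP.
by exists (b * (a : B) + c); rewrite mulrDr mulrA -bE -cE.
Qed.

HB.instance Definition _ := GRing.isSubmodClosed.Build B^c (B^c)^o
  right_ideal_pred right_ideal_submod_closed.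

Definition right_ideal := {x : (B^c)^o | x \in right_ideal_pred}.
HB.instance Definition _ := SubChoice.on right_ideal.
HB.instance Definition _ :=
  [SubChoice_isSubLmodule of right_ideal by <:].

Lemma right_ideal_fg : fin_gen (right_ideal : lmodType B^c).
Proof.
have He : (e : (B^c)^o) \in right_ideal_pred.
  by apply/asboolP; exists 1; rewrite mulr1.
exists 1%N, (fun _ => Sub (e : (B^c)^o) He : right_ideal) => -[x Hx].
have /asboolP[b bE] := Hx; exists (fun _ => b).
by rewrite big_ord1; apply: val_inj; rewrite /= bE.
Qed.

End RightIdeal.

(* Categories are enriched in setoids: [heq] is equality of morphisms. *)
Record category := Category {
  obj :> Type;
  hom : obj -> obj -> Type;
  heq : forall X Y, hom X Y -> hom X Y -> Prop;
  idm : forall X, hom X X;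
  comp : forall X Y Z, hom Y Z -> hom X Y -> hom X Z;
  heq_refl : forall X Y (f : hom X Y), heq f f;
  heq_sym : forall X Y (f g : hom X Y), heq f g -> heq g f;
  heq_trans : forall X Y (f g h : hom X Y), heq f g -> heq g h -> heq f h;
  comp_heq : forall X Y Z (g g' : hom Y Z) (f f' : hom X Y),
    heq g g' -> heq f f' -> heq (comp g f) (comp g' f');
  comp_idl : forall X Y (f : hom X Y), heq (comp (idm Y) f) f;
  comp_idr : forall X Y (f : hom X Y), heq (comp f (idm X)) f;
  comp_assoc : forall X Y Z W (h : hom Z W) (g : hom Y Z) (f : hom X Y),
    heq (comp h (comp g f)) (comp (comp h g) f)
}.

Arguments idm {_} _.
Arguments heq_refl {_ _ _} _.

Declare Scope cat_scope.
Delimit Scope cat_scope with cat.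
Local Open Scope cat_scope.
Notation "f ~~ g" := (heq f g) (at level 70, no associativity) : cat_scope.
Notation "g ** f" := (comp g f) (at level 40, left associativity) : cat_scope.

Definition is_iso (C : category) (X Y : C) (f : hom X Y) : Prop :=
  exists g : hom Y X, g ** f ~~ idm X /\ f ** g ~~ idm Y.

Definition retract (C : category) (X Y : C) : Prop :=
  exists (i : hom X Y) (r : hom Y X), r ** i ~~ idm X.

Record functor (C D : category) := Functor {
  fobj :> C -> D;
  fmap : forall X Y : C, hom X Y -> hom (fobj X) (fobj Y);
  fmap_heq : forall (X Y : C) (f g : hom X Y), f ~~ g -> fmap f ~~ fmap g;
  fmap_id : forall X : C, fmap (idm X) ~~ idm (fobj X);
  fmap_comp : forall (X Y Z : C) (g : hom Y Z) (f : hom X Y),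
    fmap (g ** f) ~~ fmap g ** fmap f
}.
Arguments fmap {_ _} _ {_ _} _.

Definition fully_faithful (C D : category) (F : functor C D) : Prop :=
  forall X Y : C,
    (forall f g : hom X Y, fmap F f ~~ fmap F g -> f ~~ g) /\
    (forall g : hom (F X) (F Y), exists f : hom X Y, fmap F f ~~ g).

Record triangle (C : category) (S : functor C C) := Triangle {
  tX : C; tY : C; tZ : C;
  tu : hom tX tY;
  tv : hom tY tZ;
  tw : hom tZ (S tX)
}.
Arguments Triangle {_ _ _ _ _} _ _ _.

Definition triangle_iso (C : category) (S : functor C C)
    (t t' : triangle S) : Prop :=
  exists (a : hom (tX t) (tX t')) (b : hom (tY t) (tY t'))
         (c : hom (tZ t) (tZ t')),
    [/\ is_iso a, is_iso b & is_iso c] /\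
    [/\ b ** tu t ~~ tu t' ** a,
        c ** tv t ~~ tv t' ** b &
        fmap S a ** tw t ~~ tw t' ** c].

(* The data of a triangulated category: suspension and distinguished
   triangles.  Among the consequences of the axioms only the one needed to
   let the suspension descend to Verdier quotients is recorded. *)
Record tricat := TriCat {
  tcat :> category;
  shift : functor tcat tcat;
  dist : triangle shift -> Prop;
  dist_shift : forall (X Y Z : tcat) (u : hom X Y) (v : hom Y Z)
      (w : hom Z (shift X)),
    dist (Triangle u v w) ->
    exists w', dist (Triangle (fmap shift u) (fmap shift v) w')
}.
Arguments shift : clear implicits.
Arguments dist {_} _.

(* Triangle functors: additivity is automatic, since a functor that commutes
   with suspensions and preserves distinguished triangles preserves zero
   objects and split triangles, hence biproducts. *)
Record triangle_functor (T T' : tricat) := TriFunctor {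
  tfun :> functor T T';
  tshift : forall X : T, hom (tfun (shift T X)) (shift T' (tfun X));
  tshift_iso : forall X, is_iso (tshift X);
  tshift_nat : forall (X Y : T) (f : hom X Y),
    tshift Y ** fmap tfun (fmap (shift T) f) ~~
    fmap (shift T') (fmap tfun f) ** tshift X;
  tfun_dist : forall t : triangle (shift T), dist t ->
    dist (Triangle (fmap tfun (tu t)) (fmap tfun (tv t))
                   (tshift (tX t) ** fmap tfun (tw t)))
}.

(* Gabriel-Zisman localization C[W^-1]: morphisms are formal composites of
   morphisms of C and of formal inverses of elements of W, modulo the
   congruence generated by the relations of C and those of an inverse. *)
Section Localization.
Variables (C : category) (W : forall X Y : C, hom X Y -> Prop).

Inductive loc_hom : C -> C -> Type :=
| Linc X Y : hom X Y -> loc_hom X Y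
| Linv X Y (s : hom X Y) : W s -> loc_hom Y X
| Lcomp X Y Z : loc_hom Y Z -> loc_hom X Y -> loc_hom X Z.

Inductive loc_eq : forall X Y : C, loc_hom X Y -> loc_hom X Y -> Prop :=
| Leq_refl X Y (f : loc_hom X Y) : loc_eq f f
| Leq_sym X Y (f g : loc_hom X Y) : loc_eq f g -> loc_eq g f
| Leq_trans X Y (f g h : loc_hom X Y) :
    loc_eq f g -> loc_eq g h -> loc_eq f h
| Leq_comp X Y Z (g g' : loc_hom Y Z) (f f' : loc_hom X Y) :
    loc_eq g g' -> loc_eq f f' -> loc_eq (Lcomp g f) (Lcomp g' f')
| Leq_idl X Y (f : loc_hom X Y) : loc_eq (Lcomp (Linc (idm Y)) f) f
| Leq_idr X Y (f : loc_hom X Y) : loc_eq (Lcomp f (Linc (idm X))) f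
| Leq_assoc X Y Z V (h : loc_hom Z V) (g : loc_hom Y Z) (f : loc_hom X Y) :
    loc_eq (Lcomp h (Lcomp g f)) (Lcomp (Lcomp h g) f)
| Leq_inc X Y (f g : hom X Y) : f ~~ g -> loc_eq (Linc f) (Linc g)
| Leq_inc_comp X Y Z (g : hom Y Z) (f : hom X Y) :
    loc_eq (Linc (g ** f)) (Lcomp (Linc g) (Linc f))
| Leq_inv_l X Y (s : hom X Y) (Ws : W s) :
    loc_eq (Lcomp (Linv Ws) (Linc s)) (Linc (idm X))
| Leq_inv_r X Y (s : hom X Y) (Ws : W s) :
    loc_eq (Lcomp (Linc s) (Linv Ws)) (Linc (idm Y)).

Definition localization : category :=
  @Category C loc_hom loc_eq (fun X => Linc (idm X)) Lcomp
    Leq_refl Leq_sym Leq_trans Leq_comp Leq_idl Leq_idr Leq_assoc.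

Lemma Linc_iso (X Y : C) (f : hom X Y) :
  is_iso f -> is_iso (Linc f : @hom localization X Y).
Proof.
case=> g [gf fg]; exists (Linc g); split.
  exact: Leq_trans (Leq_sym (Leq_inc_comp _ _)) (Leq_inc gf).
exact: Leq_trans (Leq_sym (Leq_inc_comp _ _)) (Leq_inc fg).
Qed.

End Localization.

Lemma fmap_iso (C D : category) (F : functor C D) (X Y : C) (f : hom X Y) :
  is_iso f -> is_iso (fmap F f).
Proof.
case=> g [gf fg]; exists (fmap F g); split.
  apply: heq_trans (heq_sym (fmap_comp F g f)) _.
  exact: heq_trans (fmap_heq F gf) (fmap_id F X).
apply: heq_trans (heq_sym (fmap_comp F f g)) _.
exact: heq_trans (fmap_heq F fg) (fmap_id F Y).
Qed.

Lemma fmap_square (C D : category) (F : functor C D) (X Y X' Y' : C)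
    (a : hom X X') (b : hom Y Y') (u : hom X Y) (u' : hom X' Y') :
  b ** u ~~ u' ** a -> fmap F b ** fmap F u ~~ fmap F u' ** fmap F a.
Proof.
move=> E; apply: heq_trans (heq_sym (fmap_comp F b u)) _.
exact: heq_trans (fmap_heq F E) (fmap_comp F u' a).
Qed.

Lemma dist_shift_transfer (C : category) (S : functor C C) (t t' : triangle S)
    (Z' : C) (v' : hom (S (tY t')) Z') (w' : hom Z' (S (S (tX t'))))
    (c' : hom (S (tZ t')) Z') :
  triangle_iso t t' -> is_iso c' ->
  c' ** fmap S (tv t') ~~ v' ->
  exists w : hom (S (tZ t)) (S (S (tX t))),
    triangle_iso (Triangle (fmap S (tu t)) (fmap S (tv t)) w)
                 (Triangle (fmap S (tu t')) v' w').
Proof.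
case=> a [b [c [[ia ib ic] [eu ev _]]]] [d' [dc cd]] ec.
case: (fmap_iso S (fmap_iso S ia)) => aa [aa1 aa2].
case: (fmap_iso S ic) => ci [ci1 ci2].
exists (aa ** (w' ** (c' ** fmap S c))).
exists (fmap S a), (fmap S b), (c' ** fmap S c); split; split => /=.
- exact: fmap_iso.
- exact: fmap_iso.
- exists (ci ** d'); split.
    apply: heq_trans (comp_assoc _ _ _) _; apply: heq_trans ci1.
    apply: comp_heq (heq_refl _).
    apply: heq_trans (heq_sym (comp_assoc _ _ _)) _.
    apply: heq_trans (comp_idr _).
    exact: comp_heq (heq_refl _) dc.
  apply: heq_trans (comp_assoc _ _ _) _; apply: heq_trans cd.
  apply: comp_heq (heq_refl _).
  apply: heq_trans (heq_sym (comp_assoc _ _ _)) _.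
  apply: heq_trans (comp_idr _).
  exact: comp_heq (heq_refl _) ci2.
- exact: fmap_square.
- apply: heq_trans (heq_sym (comp_assoc _ _ _)) _.
  apply: heq_trans (comp_heq (heq_refl _) (fmap_square S ev)) _.
  apply: heq_trans (comp_assoc _ _ _) _.
  exact: comp_heq ec (heq_refl _).
- apply: heq_trans (comp_assoc _ _ _) _.
  apply: heq_trans (comp_heq aa2 (heq_refl _)) _.
  exact: comp_idl.
Qed.

(* If W is stable under the suspension then T[W^-1] inherits a suspension, and
   its distinguished triangles are those isomorphic to images of
   distinguished triangles of T. *)
Section TriLocalization.
Variables (T : tricat) (W : forall X Y : T, hom X Y -> Prop).
Hypothesis W_shift : forall (X Y : T) (s : hom X Y),
  W s -> W (fmap (shift T) s).

Fixpoint loc_shift_hom (X Y : T) (f : loc_hom W X Y) :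
    loc_hom W (shift T X) (shift T Y) :=
  match f with
  | Linc _ _ g => Linc W (fmap (shift T) g)
  | Linv _ _ _ Ws => Linv (W_shift Ws)
  | Lcomp _ _ _ g h => Lcomp (loc_shift_hom g) (loc_shift_hom h)
  end.

Lemma loc_shift_heq (X Y : T) (f g : loc_hom W X Y) :
  loc_eq f g -> loc_eq (loc_shift_hom f) (loc_shift_hom g).
Proof.
have inc_id Z : loc_eq (Linc W (fmap (shift T) (idm Z)))
                       (Linc W (idm (shift T Z))).
  exact: Leq_inc (fmap_id _ _).
elim=> /=.
- by move=> *; apply: Leq_refl.
- by move=> *; apply: Leq_sym.
- by move=> X' Y' f1 g1 h1 _ E1 _ E2; apply: Leq_trans E1 E2.
- by move=> *; apply: Leq_comp.
- move=> X' Y' f1; apply: Leq_trans (Leq_idl _).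
  exact: Leq_comp (inc_id _) (Leq_refl _).
- move=> X' Y' f1; apply: Leq_trans (Leq_idr _).
  exact: Leq_comp (Leq_refl _) (inc_id _).
- by move=> *; apply: Leq_assoc.
- by move=> X' Y' f1 g1 E; apply/Leq_inc/fmap_heq.
- move=> X' Y' Z' g1 f1; apply: Leq_trans (Leq_inc_comp _ _ _).
  exact/Leq_inc/fmap_comp.
- move=> X' Y' s Ws.
  exact: Leq_trans (Leq_inv_l _) (Leq_sym (inc_id _)).
- move=> X' Y' s Ws.
  exact: Leq_trans (Leq_inv_r _) (Leq_sym (inc_id _)).
Qed.

Definition loc_shift : functor (localization W) (localization W) :=
  @Functor (localization W) (localization W) (shift T) loc_shift_hom
    loc_shift_heq (fun X => Leq_inc W (fmap_id (shift T) X))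
    (fun X Y Z g f => Leq_refl _).

Definition loc_triangle (t : triangle (shift T)) : triangle loc_shift :=
  @Triangle (localization W) loc_shift (tX t) (tY t) (tZ t)
    (Linc W (tu t)) (Linc W (tv t)) (Linc W (tw t)).

Definition loc_dist (t : triangle loc_shift) : Prop :=
  exists t' : triangle (shift T), dist t' /\ triangle_iso t (loc_triangle t').

Lemma loc_dist_shift (X Y Z : localization W) (u : hom X Y) (v : hom Y Z)
    (w : hom Z (loc_shift X)) :
  loc_dist (Triangle u v w) ->
  exists w', loc_dist (Triangle (fmap loc_shift u) (fmap loc_shift v) w').
Proof.
case=> -[X' Y' Z' u' v' w'] [/dist_shift[w2 D] I].
have iid : @is_iso (localization W) _ _ (Linc W (idm (shift T Z'))).
  by exists (Linc W (idm _)); split; apply: Leq_idl.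
have [w3 I3] := @dist_shift_transfer (localization W) loc_shift
  (Triangle u v w) (loc_triangle (Triangle u' v' w')) (shift T Z')
  (Linc W (fmap (shift T) v')) (Linc W w2) (Linc W (idm (shift T Z'))) I
  iid (Leq_idl _).
by exists w3, (Triangle (fmap (shift T) u') (fmap (shift T) v') w2).
Qed.

Definition tri_localization : tricat := TriCat loc_dist_shift.

End TriLocalization.

Section Thick.
Variable T : tricat.

Definition thick_subcategory (P : T -> Prop) : Prop :=
  [/\ forall X, P X <-> P (shift T X),
      forall t : triangle (shift T), dist t ->
        [/\ P (tX t) -> P (tY t) -> P (tZ t),
            P (tY t) -> P (tZ t) -> P (tX t) &
            P (tX t) -> P (tZ t) -> P (tY t)]
    & forall X Y, retract X Y -> P Y -> P X].

Definition thick (G : T) : T -> Prop :=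
  fun X => forall P, thick_subcategory P -> P G -> P X.

Lemma thick_is_thick (G : T) : thick_subcategory (thick G).
Proof.
split.
- move=> X; split=> H P tP PG; case: (tP) => [HS _ _].
    by apply/(HS X); apply: H.
  by apply/(HS X); apply: H.
- move=> t Dt; split=> H1 H2 P tP PG; case: (tP) => [_ /(_ t Dt)[A B C] _].
  + by apply: A; [apply: H1 | apply: H2].
  + by apply: B; [apply: H1 | apply: H2].
  + by apply: C; [apply: H1 | apply: H2].
- move=> X Y rXY H P tP PG; case: (tP) => [_ _ HR].
  by apply: HR rXY _; apply: H.
Qed.

(* The Verdier quotient T/P inverts the morphisms with a cone in P. *)
Definition cone_in (P : T -> Prop) (X Y : T) (s : hom X Y) : Prop :=
  exists (Z : T) (v : hom Y Z) (w : hom Z (shift T X)),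
    dist (Triangle s v w) /\ P Z.

Lemma cone_in_shift (P : T -> Prop) (thP : thick_subcategory P)
    (X Y : T) (s : hom X Y) :
  cone_in P s -> cone_in P (fmap (shift T) s).
Proof.
case: thP => HS _ _ [Z [v [w [/dist_shift[w' D] PZ]]]].
by exists (shift T Z), (fmap (shift T) v), w'; split; last exact: (HS Z).1.
Qed.

Definition verdier_quotient (P : T -> Prop) (thP : thick_subcategory P)
    : tricat :=
  tri_localization (cone_in_shift thP).

End Thick.

(* Bounded cochain complexes of finitely generated left S-modules.  Degrees
   are written i + 1 rather than i wherever this avoids transporting along an
   equality of degrees. *)
Section Complexes.
Variable S : pzRingType.

Record complex := Complex {
  cmod :> int -> lmodType S;
  cd : forall i, {linear cmod i -> cmod (i + 1)};
  cfg : forall i, fin_gen (cmod i);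
  cdd : forall i (x : cmod i), cd (i + 1) (cd i x) = 0;
  cbound : exists n : int, forall i, (n < i) || (i < - n) ->
    forall x : cmod i, x = 0
}.

Record chain_map (X Y : complex) := ChainMap {
  cmap :> forall i, {linear X i -> Y i};
  cmapd : forall i (x : X i), cmap (i + 1) (cd X i x) = cd Y i (cmap i x)
}.

Definition homotopic (X Y : complex) (f g : chain_map X Y) : Prop :=
  exists h : forall i, {linear X (i + 1) -> Y i},
    forall i (x : X (i + 1)),
      f (i + 1) x - g (i + 1) x =
      cd Y i (h i x) + h (i + 1) (cd X (i + 1) x).

Definition chain_id (X : complex) : chain_map X X :=
  @ChainMap X X (fun i => id_linear (X i))
    (fun i x => erefl).

Fact chain_comp_subproof (X Y Z : complex)
    (g : chain_map Y Z) (f : chain_map X Y) i (x : X i) :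
  comp_linear (g (i + 1)) (f (i + 1)) (cd X i x) =
  cd Z i (comp_linear (g i) (f i) x).
Proof. by rewrite /= !cmapd. Qed.

Definition chain_comp (X Y Z : complex)
    (g : chain_map Y Z) (f : chain_map X Y) : chain_map X Z :=
  ChainMap (chain_comp_subproof g f).

Lemma homotopic_ext (X Y : complex) (f g : chain_map X Y) :
  (forall i x, f (i + 1) x = g (i + 1) x) -> homotopic f g.
Proof.
move=> E; exists (fun i => zero_linear (X (i + 1)) (Y i)) => i x /=.
by rewrite E subrr linear0 addr0.
Qed.

Lemma homotopic_refl (X Y : complex) (f : chain_map X Y) : homotopic f f.
Proof. exact: homotopic_ext. Qed.

Lemma homotopic_sym (X Y : complex) (f g : chain_map X Y) :
  homotopic f g -> homotopic g f.
Proof.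
case=> h E; exists (fun i => opp_linear (h i)) => i x /=.
by rewrite linearN -opprD -E opprB.
Qed.

Lemma homotopic_trans (X Y : complex) (f g k : chain_map X Y) :
  homotopic f g -> homotopic g k -> homotopic f k.
Proof.
case=> h E [h' E']; exists (fun i => add_linear (h i) (h' i)) => i x /=.
by rewrite linearD addrACA -E -E' addrA subrK.
Qed.

Lemma homotopic_comp (X Y Z : complex)
    (g g' : chain_map Y Z) (f f' : chain_map X Y) :
  homotopic g g' -> homotopic f f' ->
  homotopic (chain_comp g f) (chain_comp g' f').
Proof.
case=> h' E' [h E].
exists (fun i => add_linear (comp_linear (g i) (h i))
                            (comp_linear (h' i) (f' (i + 1)))) => i x /=.
rewrite linearD addrACA -(cmapd g) (cmapd f') -linearD -E -E' linearB addrA.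
by rewrite subrK.
Qed.

Definition homotopy_category : category :=
  @Category complex chain_map homotopic chain_id chain_comp
    homotopic_refl homotopic_sym homotopic_trans homotopic_comp
    (fun X Y f => homotopic_refl _) (fun X Y f => homotopic_refl _)
    (fun X Y Z V h g f => homotopic_refl _).

Fact shift_cdd (X : complex) i (x : X (i + 1)) :
  opp_linear (cd X (i + 1 + 1)) (opp_linear (cd X (i + 1)) x) = 0.
Proof. by rewrite /= linearN cdd oppr0 oppr0. Qed.

Fact shift_cbound (X : complex) : exists n : int,
  forall i, (n < i) || (i < - n) -> forall x : X (i + 1), x = 0.
Proof.
by have [n Hn] := cbound X; exists (n + 1) => i Hi x; apply: Hn; lia.
Qed.

Definition cshift (X : complex) : complex :=
  @Complex (fun i => X (i + 1)) (fun i => opp_linear (cd X (i + 1)))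
    (fun i => cfg X (i + 1)) (@shift_cdd X) (shift_cbound X).

Fact shift_cmapd (X Y : complex) (f : chain_map X Y) i (x : cshift X i) :
  f (i + 1 + 1) (cd (cshift X) i x) = cd (cshift Y) i (f (i + 1) x).
Proof. by rewrite /= linearN cmapd. Qed.

Definition cshift_map (X Y : complex) (f : chain_map X Y) :
    chain_map (cshift X) (cshift Y) :=
  @ChainMap (cshift X) (cshift Y) (fun i => f (i + 1)) (shift_cmapd f).

Lemma cshift_homotopic (X Y : complex) (f g : chain_map X Y) :
  homotopic f g -> homotopic (cshift_map f) (cshift_map g).
Proof.
case=> h E; exists (fun i => opp_linear (h (i + 1))) => i x /=.
by rewrite E !linearN !opprK.
Qed.

Definition homotopy_shift : functor homotopy_category homotopy_category :=
  @Functor homotopy_category homotopy_category cshift cshift_map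
    cshift_homotopic (fun X => homotopic_refl _)
    (fun X Y Z g f => homotopic_refl _).

Section Cone.
Variables (X Y : complex) (f : chain_map X Y).

Definition cone_mod (i : int) : lmodType S :=
  (X (i + 1)%R * Y i)%type.

Definition cone_dfun i (p : cone_mod i) : cone_mod (i + 1) :=
  (- cd X (i + 1) p.1, f (i + 1) p.1 + cd Y i p.2).

Fact cone_dfun_linear i : linear (@cone_dfun i).
Proof.
move=> a p q; congr (_, _) => /=.
  by rewrite (linearP (cd X (i + 1))) opprD scalerN.
by rewrite !linearP scalerDr addrACA.
Qed.

Definition cone_d i : {linear cone_mod i -> cone_mod (i + 1)} :=
  mk_linear (@cone_dfun_linear i).

Fact cone_fg i : fin_gen (cone_mod i).
Proof.
have [n [v Hv]] := cfg X (i + 1); have [m [w Hw]] := cfg Y i.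
exists (n + m)%N, (fun j => match split j with
  | inl l => (v l, 0) | inr r => (0, w r) end) => -[x y].
have [a Ea] := Hv x; have [b Eb] := Hw y.
exists (fun j => match split j with inl l => a l | inr r => b r end).
rewrite big_split_ord /=.
under eq_bigr => j _ do rewrite (unsplitK (inl _ j : 'I_n + 'I_m)).
under [X in _ = _ + X]eq_bigr => j _ do
  rewrite (unsplitK (inr _ j : 'I_n + 'I_m)).
rewrite Ea Eb [RHS]surjective_pairing /=; congr (_, _).
  rewrite !raddf_sum /= [X in _ = _ + X]big1 ?addr0 // => j _.
  exact: scaler0.
rewrite !raddf_sum /= [X in _ = X + _]big1 ?add0r // => j _.
exact: scaler0.
Qed.

Fact cone_dd i (p : cone_mod i) : cone_d (i + 1) (cone_d i p) = 0.
Proof.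
congr (_, _) => /=; first by rewrite linearN cdd !oppr0.
by rewrite linearN linearD cdd addr0 cmapd addNr.
Qed.

Fact cone_bound : exists n : int,
  forall i, (n < i) || (i < - n) -> forall p : cone_mod i, p = 0.
Proof.
have [n Hn] := cbound X; have [m Hm] := cbound Y.
exists (`|n| + `|m| + 1) => i Hi [x y]; congr (_, _).
  by apply: Hn; lia.
by apply: Hm; lia.
Qed.

Definition cone : complex := Complex cone_fg cone_dd cone_bound.

Fact cone_in_linear i : linear (fun y : Y i => (0, y) : cone i).
Proof.
by move=> a y z; congr (_, _); rewrite /= scaler0 addr0.
Qed.

Fact cone_in_chain i (y : Y i) :
  mk_linear (@cone_in_linear (i + 1)) (cd Y i y) =
  cd cone i (mk_linear (@cone_in_linear i) y).
Proof. by congr (_, _); rewrite /= linear0 ?oppr0 ?add0r. Qed.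

Definition cone_inj : chain_map Y cone := ChainMap cone_in_chain.

Fact cone_proj_linear i : linear (fun p : cone i => p.1 : cshift X i).
Proof. by []. Qed.

Definition cone_proj : chain_map cone (cshift X) :=
  @ChainMap cone (cshift X) (fun i => mk_linear (@cone_proj_linear i))
    (fun i p => erefl).

(* Signs: d_{X[1]} = - d_X, d_cone (x, y) = (- d x, f x + d y), and the third
   map is the projection (x, y) |-> x. *)
Definition cone_triangle : triangle homotopy_shift :=
  @Triangle homotopy_category homotopy_shift X Y cone f cone_inj cone_proj.

End Cone.

Definition homotopy_dist (t : triangle homotopy_shift) : Prop :=
  exists (X Y : complex) (f : chain_map X Y),
    triangle_iso t (cone_triangle f).

Section ConeShift.
Variables (X Y : complex) (f : chain_map X Y).

Fact cone_sign_linear i :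
  linear (fun p : cone_mod X Y (i + 1) => (- p.1, p.2) : cone_mod X Y (i + 1)).
Proof.
by move=> a p q; congr (_, _) => /=; rewrite opprD scalerN.
Qed.

Fact cone_shift_chain i (p : cshift (cone f) i) :
  mk_linear (@cone_sign_linear (i + 1)) (cd (cshift (cone f)) i p) =
  cd (cone (cshift_map f)) i (mk_linear (@cone_sign_linear i) p).
Proof.
congr (_, _) => /=; first by rewrite (linearN (cd X (i + 1 + 1))).
by rewrite (linearN (f (i + 1 + 1))) opprD.
Qed.

Definition cone_shift : chain_map (cshift (cone f)) (cone (cshift_map f)) :=
  @ChainMap (cshift (cone f)) (cone (cshift_map f))
    (fun i => mk_linear (@cone_sign_linear i)) cone_shift_chain.

Fact cone_unshift_chain i (p : cone (cshift_map f) i) :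
  mk_linear (@cone_sign_linear (i + 1)) (cd (cone (cshift_map f)) i p) =
  cd (cshift (cone f)) i (mk_linear (@cone_sign_linear i) p).
Proof.
congr (_, _) => /=; first by rewrite (linearN (cd X (i + 1 + 1))).
by rewrite (linearN (f (i + 1 + 1))) opprD opprK.
Qed.

Definition cone_unshift : chain_map (cone (cshift_map f)) (cshift (cone f)) :=
  @ChainMap (cone (cshift_map f)) (cshift (cone f))
    (fun i => mk_linear (@cone_sign_linear i)) cone_unshift_chain.

Lemma cone_shift_iso :
  @is_iso homotopy_category (cshift (cone f)) (cone (cshift_map f)) cone_shift.
Proof.
by exists cone_unshift; split; apply: homotopic_ext => i [x y] /=;
  rewrite opprK.
Qed.

End ConeShift.

Lemma homotopy_dist_shift (X Y Z : homotopy_category) (u : hom X Y)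
    (v : hom Y Z) (w : hom Z (homotopy_shift X)) :
  homotopy_dist (Triangle u v w) ->
  exists w', homotopy_dist
    (Triangle (fmap homotopy_shift u) (fmap homotopy_shift v) w').
Proof.
case=> X' [Y' [f I]].
have [|w3 I3] := @dist_shift_transfer homotopy_category homotopy_shift
  (Triangle u v w) (cone_triangle f)
  (cone (cshift_map f)) (cone_inj (cshift_map f)) (cone_proj (cshift_map f))
  (cone_shift f) I (cone_shift_iso f).
  by apply: homotopic_ext => i x; congr (_, _); rewrite /= oppr0.
by exists w3, (cshift X'), (cshift Y'), (cshift_map f).
Qed.

Definition Kb : tricat := TriCat homotopy_dist_shift.

(* Injectivity and surjectivity of H^(i+1)(f) : ker d / im d -> ker d / im d. *)
Definition quasi_iso (X Y : Kb) (f : @hom Kb X Y) : Prop :=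
  forall i : int,
    (forall x : cmod X (i + 1), cd X (i + 1) x = 0 ->
       (exists y : cmod Y i, cmap f (i + 1) x = cd Y i y) ->
       exists x' : cmod X i, x = cd X i x') /\
    (forall y : cmod Y (i + 1), cd Y (i + 1) y = 0 ->
       exists x : cmod X (i + 1), cd X (i + 1) x = 0 /\
         exists y' : cmod Y i, y = cmap f (i + 1) x + cd Y i y').

Lemma quasi_iso_shift (X Y : Kb) (f : @hom Kb X Y) :
  quasi_iso f -> quasi_iso (fmap (shift Kb) f).
Proof.
move=> qf i; have [inj sur] := qf (i + 1); split=> /=.
  move=> x /eqP; rewrite oppr_eq0 => /eqP dx [y E].
  have [|x' ->] := inj x dx; first by exists (- y); rewrite linearN.
  by exists (- x'); rewrite linearN opprK.
move=> y /eqP; rewrite oppr_eq0 => /eqP /sur[x [dx [y' ->]]].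
exists x; split; first by rewrite dx oppr0.
by exists (- y'); rewrite linearN opprK.
Qed.

Definition Db : tricat := tri_localization quasi_iso_shift.

Section Stalk.
Variables (M : lmodType S) (Mfg : fin_gen M).

Definition stalk_mod (i : int) : lmodType S :=
  if i == 0 then M else 'rV[S]_0.

Fact stalk_fg i : fin_gen (stalk_mod i).
Proof.
rewrite /stalk_mod; case: ifP => // _.
by exists 0%N, (fun _ => 0) => x; exists (fun _ => 0);
  rewrite big_ord0 [x]thinmx0.
Qed.

Fact stalk_bound : exists n : int,
  forall i, (n < i) || (i < - n) -> forall x : stalk_mod i, x = 0.
Proof.
exists 0 => i Hi; rewrite /stalk_mod; case: ifP => [/eqP|_ x]; first by lia.
by rewrite [x]thinmx0.
Qed.

Definition stalk : complex :=
  @Complex stalk_mod (fun i => zero_linear (stalk_mod i) (stalk_mod (i + 1)))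
    stalk_fg (fun i x => erefl) stalk_bound.

End Stalk.

End Complexes.

Definition Db_mod (B : pzRingType) : tricat := Db B^c.

Section RelativeSingularityCategory.
Variables (R : comPzRingType) (H : lmodType R).

Definition End_R_plus : pzRingType := endo ((R^o * H)%type : lmodType R).

Fact idem_R_linear :
  linear (fun p : (R^o * H)%type => (p.1, 0) : (R^o * H)%type).
Proof. by move=> a p q; congr (_, _); rewrite /= scaler0 addr0. Qed.

Definition idem_R : End_R_plus := mk_linear idem_R_linear.

Definition eB : Db_mod End_R_plus := stalk (right_ideal_fg idem_R).

(* The image of K^b(proj-R) in D^b(mod-B) is thick(e_B B). *)
Definition rel_sing_cat : tricat := verdier_quotient (thick_is_thick eB).

End RelativeSingularityCategory.

(* Main.v *)
(* Write G' = F' + F'', A = End(R + F') and let e in A' be the idempotent with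
   image R + F', so that A = eA'e.  Passing to the corner, N |-> Ne, is an exact
   functor mod-A' -> mod-A, which maps e_{A'}A' to e_A A.  As A is right
   noetherian of finite global dimension, every bounded complex X of finitely
   generated A-modules is quasi-isomorphic to the corner Qe of a bounded complex
   Q of direct summands of powers of eA'; such a Q plays the role of
   X (x)^L_A eA'.  Homotopy classes of maps Q -> Y agree with those of maps
   Qe -> Ye and are insensitive to quasi-isomorphisms of their target, so
   X |-> Q is a triangle functor, left adjoint to passing to the corner, with
   invertible unit.  Both functors respect the subcategories generated by e_A A
   and e_{A'}A', hence induce an adjunction with invertible unit between the
   Verdier quotients, and the left adjoint of such an adjunction is fully
   faithful; no calculus of fractions is involved. *)
Require Import Defs.
From HB Require Import structures.
From Stdlib Require Import Setoid Morphisms.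
From mathcomp Require Import all_boot all_order all_algebra.
From mathcomp Require Import boolp zify.
(* MathComp shadows [comp] and [hom]. *)
Import Defs.

Set Implicit Arguments.
Unset Strict Implicit.
Unset Printing Implicit Defensive.

Import Order.TTheory GRing.Theory Num.Theory.
Local Open Scope ring_scope.
Local Open Scope cat_scope.

(** * Functors on localizations *)

(** Finite global dimension is what keeps Q bounded, so that the left adjoint stays inside bounded
    complexes of finitely generated modules. Resolutions are merely chosen, object by object.
    Functoriality, exactness and the adjunction all come from one fact: a map from Qe to Z lifts,
    uniquely up to homotopy, to a map Q -> Y through any quasi-isomorphism Ye -> Z. Such lifts exist
    because a module map out of Q is determined by its values on elements fixed by e, where the
    projectivity of Qe takes over.

    The generators match because e_{A'} lies in the corner eA'e: hence e_{A'}A' is a summand of eA',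
    its corner is e_A A, and the stalk complex of e_{A'}A' is itself a resolution of that of e_A A.

    In a localization morphisms are formal composites. Naturality is therefore checked on the
    morphisms of the original category, once for the derived category and once more for the Verdier
    quotient. *)

#[local] Instance heq_equivalence (C : category) (X Y : C) :
  Equivalence (@heq C X Y).
Proof.
by split=> [f|f g|f g h]; [exact: heq_refl|exact: heq_sym|exact: heq_trans].
Qed.

#[local] Hint Resolve heq_refl : core.

#[local] Instance comp_proper (C : category) (X Y Z : C) :
  Proper (@heq C Y Z ==> @heq C X Y ==> @heq C X Z) (@comp C X Y Z).
Proof. by move=> g g' Eg f f' Ef; apply: comp_heq. Qed.

#[local] Instance fmap_proper (C D : category) (F : functor C D) (X Y : C) :
  Proper (@heq C X Y ==> @heq D (F X) (F Y)) (@fmap C D F X Y).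
Proof. by move=> f g; apply: fmap_heq. Qed.

Section CategoryLemmas.
Variables (C D E : category).
Implicit Types X Y Z : C.

Lemma iso_id X : is_iso (idm X).
Proof. by exists (idm X); split; apply: comp_idl. Qed.

Lemma iso_comp X Y Z (g : hom Y Z) (f : hom X Y) :
  is_iso g -> is_iso f -> is_iso (g ** f).
Proof.
case=> g' [g'g gg'] [f' [f'f ff']]; exists (f' ** g'); split.
  by rewrite -comp_assoc (comp_assoc g') g'g comp_idl.
by rewrite -comp_assoc (comp_assoc f) ff' comp_idl.
Qed.

Lemma iso_retract X Y (f : hom X Y) : is_iso f -> retract X Y.
Proof. by case=> g [gf _]; exists f, g. Qed.

Lemma iso_sym X Y (f : hom X Y) : is_iso f -> exists g : hom Y X, is_iso g.
Proof. by case=> g [gf fg]; exists g, f. Qed.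

Lemma triangle_iso_trans (S : functor C C) (t1 t2 t3 : triangle S) :
  triangle_iso t1 t2 -> triangle_iso t2 t3 -> triangle_iso t1 t3.
Proof.
case=> a [b [c [[ia ib ic] [eu ev ew]]]] [a' [b' [c' [iabc' euvw']]]].
case: iabc' euvw' => ia' ib' ic' [eu' ev' ew'].
exists (a' ** a), (b' ** b), (c' ** c); split; split; try exact: iso_comp.
- by rewrite -comp_assoc eu !comp_assoc eu'.
- by rewrite -comp_assoc ev !comp_assoc ev'.
- by rewrite fmap_comp -comp_assoc ew !comp_assoc ew'.
Qed.

Fact idF_heq X Y (f g : hom X Y) : f ~~ g -> f ~~ g. Proof. by []. Qed.
Definition id_functor : functor C C :=
  @Functor C C (fun X => X) (fun X Y f => f) idF_heq
    (fun X => heq_refl _) (fun X Y Z g f => heq_refl _).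

Section Composition.
Variables (G : functor D E) (F : functor C D).
Fact compF_heq X Y (f g : hom X Y) :
  f ~~ g -> fmap G (fmap F f) ~~ fmap G (fmap F g).
Proof. by move=> fg; rewrite fg. Qed.
Fact compF_id X : fmap G (fmap F (idm X)) ~~ idm (G (F X)).
Proof. by rewrite !fmap_id. Qed.
Fact compF_comp X Y Z (g : hom Y Z) (f : hom X Y) :
  fmap G (fmap F (g ** f)) ~~ fmap G (fmap F g) ** fmap G (fmap F f).
Proof. by rewrite !fmap_comp. Qed.
Definition comp_functor : functor C E :=
  @Functor C E (fun X => G (F X)) (fun X Y f => fmap G (fmap F f))
    compF_heq compF_id compF_comp.
End Composition.

(* A functor with a right adjoint is fully faithful when the unit is
   invertible; [s] is the inverse of the unit. *)
Lemma fully_faithful_criterion (F : functor C D) (G : functor D C)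
    (s : forall X, hom (G (F X)) X) (e : forall Y : D, hom (F (G Y)) Y) :
  (forall X, is_iso (s X)) ->
  (forall X Y (f : hom X Y), s Y ** fmap G (fmap F f) ~~ f ** s X) ->
  (forall (X Y : D) (g : hom X Y), e Y ** fmap F (fmap G g) ~~ g ** e X) ->
  (forall X, e (F X) ~~ fmap F (s X)) ->
  fully_faithful F.
Proof.
move=> s_iso s_nat e_nat e_s X Y; split=> [f g Ff|g].
  have [t [_ st]] := s_iso X.
  by rewrite -[f]comp_idr -[g]comp_idr -st !comp_assoc -!s_nat Ff.
have [t [ts st]] := s_iso X.
(* This is [G g] conjugated by the unit. Under [F] the factor [F (s Y)] becomes [e (F Y)], and
   naturality of [e] brings [g] to the front. *)
exists (s Y ** fmap G g ** t).
rewrite !fmap_comp -e_s e_nat e_s -comp_assoc -fmap_comp st fmap_id.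
exact: comp_idr.
Qed.

End CategoryLemmas.

Section LocalizationFunctors.
Variables (C D : category) (W : forall X Y : C, hom X Y -> Prop).

Definition loc_functor : functor C (localization W) :=
  @Functor C (localization W) (fun X => X) (fun X Y f => Linc W f)
    (fun X Y f g fg => Leq_inc W fg) (fun X => Leq_refl _)
    (fun X Y Z g f => Leq_inc_comp W g f).

Variables (F : functor C D)
  (F_inv : forall (X Y : C) (s : hom X Y), W s -> is_iso (fmap F s)).

(** [is_iso] only asserts that an inverse exists, so [cid] picks one; the value at [Linv Ws] depends
    on the proof [Ws] only up to [~~]. *)
Fixpoint loc_lift_hom (X Y : C) (f : loc_hom W X Y) : hom (F X) (F Y) :=
  match f with
  | Linc _ _ g => fmap F g
  | Linv _ _ _ Ws => projT1 (cid (F_inv Ws))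
  | Lcomp _ _ _ g h => loc_lift_hom g ** loc_lift_hom h
  end.

Lemma loc_lift_heq (X Y : C) (f g : loc_hom W X Y) :
  loc_eq f g -> loc_lift_hom f ~~ loc_lift_hom g.
Proof.
elim=> /= *; try by [].
- by symmetry.
- by etransitivity; eassumption.
- exact: comp_heq.
- by rewrite fmap_id comp_idl.
- by rewrite fmap_id comp_idr.
- exact: comp_assoc.
- exact: fmap_heq.
- exact: fmap_comp.
- by case: cid => t /= [-> _]; rewrite fmap_id.
- by case: cid => t /= [_ ->]; rewrite fmap_id.
Qed.

Definition loc_lift : functor (localization W) D :=
  @Functor (localization W) D F loc_lift_hom loc_lift_heq
    (fun X => fmap_id F X) (fun X Y Z g f => heq_refl _).

(* Naturality at a formal inverse follows from naturality at the morphism it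
   inverts. *)
Lemma loc_natural (G H : functor (localization W) D)
    (a : forall X : C, hom (G X) (H X)) :
  (forall (X Y : C) (f : hom X Y),
     a Y ** fmap G (Linc W f) ~~ fmap H (Linc W f) ** a X) ->
  forall (X Y : localization W) (f : hom X Y),
    a Y ** fmap G f ~~ fmap H f ** a X.
Proof.
move=> a_nat X Y; elim=> {X Y} [X Y f|X Y s Ws|X Y Z g IHg f IHf].
- exact: a_nat.
- pose s0 : @hom (localization W) X Y := Linc W s.
  pose t0 : @hom (localization W) Y X := Linv Ws.
  have ts : t0 ** s0 ~~ idm _ by apply: Leq_inv_l.
  have st : s0 ** t0 ~~ idm _ by apply: Leq_inv_r.
  rewrite -[a X ** _]comp_idl -(fmap_id H X) -ts fmap_comp -comp_assoc.
  rewrite (comp_assoc (fmap H s0)) -a_nat -comp_assoc -fmap_comp st.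
  by rewrite fmap_id comp_idr.
- pose g0 : @hom (localization W) Y Z := g.
  pose f0 : @hom (localization W) X Y := f.
  rewrite -[Lcomp g f]/(g0 ** f0) !fmap_comp comp_assoc.
  by rewrite IHg -comp_assoc IHf comp_assoc.
Qed.

End LocalizationFunctors.

Section TriangleImage.
Variables (C D : category) (SC : functor C C) (SD : functor D D).
Variables (F : functor C D) (th : forall X : C, hom (F (SC X)) (SD (F X))).
Hypothesis th_nat : forall (X Y : C) (f : hom X Y),
  th Y ** fmap F (fmap SC f) ~~ fmap SD (fmap F f) ** th X.

(** Stated for a bare functor with a natural comparison [th], so that it is available while
    preservation of distinguished triangles is still being proved. *)
Definition triangle_image (t : triangle SC) : triangle SD :=
  Triangle (fmap F (tu t)) (fmap F (tv t)) (th (tX t) ** fmap F (tw t)).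

Lemma triangle_image_iso (t t' : triangle SC) :
  triangle_iso t t' -> triangle_iso (triangle_image t) (triangle_image t').
Proof.
case=> a [b [c [[ia ib ic] [eu ev ew]]]].
exists (fmap F a), (fmap F b), (fmap F c); split; split => /=.
- exact: fmap_iso.
- exact: fmap_iso.
- exact: fmap_iso.
- exact: fmap_square.
- exact: fmap_square.
- by rewrite comp_assoc -th_nat -comp_assoc -fmap_comp ew fmap_comp comp_assoc.
Qed.

End TriangleImage.

Section TriangulatedLocalization.
Variables (T T' : tricat).
Variables (W : forall X Y : T, hom X Y -> Prop)
          (W' : forall X Y : T', hom X Y -> Prop).
Hypothesis W_shift : forall (X Y : T) (s : hom X Y),
  W s -> W (fmap (shift T) s).
Hypothesis W'_shift : forall (X Y : T') (s : hom X Y),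
  W' s -> W' (fmap (shift T') s).
Variable F : triangle_functor T T'.
(** Asking only for invertibility after localization covers both functors at once: resolution turns
    quasi-isomorphisms into isomorphisms, while the corner keeps them quasi-isomorphisms. *)
Hypothesis F_inv : forall (X Y : T) (s : hom X Y),
  W s -> @is_iso (localization W') (F X) (F Y) (Linc W' (fmap F s)).

Definition loc_map : functor (localization W) (localization W') :=
  @loc_lift T _ W (comp_functor (loc_functor W') F) F_inv.

Let th (X : T) : @hom (localization W') (F (shift T X)) (shift T' (F X)) :=
  Linc W' (tshift F X).

Lemma loc_map_shift_iso (X : T) : is_iso (th X).
Proof. exact/Linc_iso/tshift_iso. Qed.

Lemma loc_map_shift_nat (X Y : localization W) (f : hom X Y) :
  th Y ** fmap loc_map (fmap (loc_shift W_shift) f) ~~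
  fmap (loc_shift W'_shift) (fmap loc_map f) ** th X.
Proof.
apply: (@loc_natural _ _ _
  (comp_functor loc_map (loc_shift W_shift))
  (comp_functor (loc_shift W'_shift) loc_map)) => {f} {}X {}Y f /=.
exact: Leq_trans (Leq_sym (Leq_inc_comp _ _ _))
  (Leq_trans (Leq_inc _ (tshift_nat F f)) (Leq_inc_comp _ _ _)).
Qed.

Lemma loc_map_dist (t : triangle (loc_shift W_shift)) :
  loc_dist t -> loc_dist (@triangle_image _ _ (loc_shift W_shift)
    (loc_shift W'_shift) loc_map th t).
Proof.
case=> t' [Dt' It]; exists (triangle_image (tshift F) t'); split.
  exact: tfun_dist.
have I := @triangle_image_iso _ _ (loc_shift W_shift) (loc_shift W'_shift)
  loc_map th loc_map_shift_nat _ _ It.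
refine (triangle_iso_trans I _) => {I It}.
exists (idm _), (idm _), (idm _); split; split; try exact: iso_id.
- by rewrite comp_idl comp_idr.
- by rewrite comp_idl comp_idr.
- rewrite fmap_id comp_idl comp_idr /=.
  exact: Leq_sym (Leq_inc_comp _ _ _).
Qed.

Definition tri_loc_map :
    triangle_functor (tri_localization W_shift) (tri_localization W'_shift) :=
  @TriFunctor (tri_localization W_shift) (tri_localization W'_shift)
    loc_map th loc_map_shift_iso loc_map_shift_nat loc_map_dist.

End TriangulatedLocalization.

Lemma thick_iso (T : tricat) (P : T -> Prop) (X Y : T) (f : hom X Y) :
  thick_subcategory P -> is_iso f -> P X <-> P Y.
Proof.
case=> _ _ HR fI; split.
  by have [g /iso_retract gI] := iso_sym fI; apply: HR.
by apply: HR; apply: iso_retract fI.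
Qed.

Section VerdierFunctors.
Variables (T T' : tricat) (F : triangle_functor T T').

Variables (G : T) (G' : T').
Hypothesis F_gen : thick G' (F G).

(** The objects that [F] sends into [thick G'] form a thick subcategory containing [G]. *)
Lemma thick_image (X : T) : thick G X -> thick G' (F X).
Proof.
move=> thX; have thG' := thick_is_thick G'; have [HS HT HR] := thG'.
apply: (thX (fun X => thick G' (F X)) _ F_gen).
split=> [Y|t Dt|Y Z [i [r ri]]].
- by rewrite (thick_iso thG' (tshift_iso F Y)).
- exact: HT (tfun_dist F Dt).
- by apply: HR; exists (fmap F i), (fmap F r); rewrite -fmap_comp ri fmap_id.
Qed.

Lemma cone_in_image (X Y : T) (s : hom X Y) :
  cone_in (thick G) s ->
  @is_iso (localization (@cone_in T' (thick G'))) (F X) (F Y)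
    (Linc _ (fmap F s)).
Proof.
case=> Z [v [w [Dt GZ]]].
have Ws : cone_in (thick G') (fmap F s).
  by exists (F Z), (fmap F v), (tshift F X ** fmap F w); split;
    [apply: tfun_dist Dt | apply: thick_image].
by exists (Linv Ws); split; [apply: Leq_inv_l | apply: Leq_inv_r].
Qed.

Definition verdier_map : triangle_functor
    (verdier_quotient (thick_is_thick G)) (verdier_quotient (thick_is_thick
      G')) :=
  tri_loc_map (cone_in_shift (thick_is_thick G))
    (cone_in_shift (thick_is_thick G')) cone_in_image.

End VerdierFunctors.

(** * Linear algebra *)

Section Submodules.
Variables (S : pzRingType) (V : lmodType S).

Record submodule := Submodule {
  submod_pred :> {pred V};
  submod_predP : submod_closed submod_pred
}.

Variable p : submodule.
HB.instance Definition _ :=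
  GRing.isSubmodClosed.Build S V (submod_pred p) (submod_predP p).

Definition submod_type := {x : V | x \in submod_pred p}.
HB.instance Definition _ := SubChoice.on submod_type.
HB.instance Definition _ := [SubChoice_isSubLmodule of submod_type by <:].

Fact submod_val_linear : linear (fun x : submod_type => val x).
Proof. by move=> a x y; rewrite linearP. Qed.
Definition submod_val : {linear submod_type -> V} :=
  mk_linear submod_val_linear.

Lemma submod_valP (x : submod_type) : submod_val x \in submod_pred p.
Proof. exact: valP. Qed.

Lemma submod_val_inj : injective submod_val.
Proof. exact: val_inj. Qed.

Section Corestriction.
Variables (U : lmodType S) (f : {linear U -> V}).
Hypothesis f_in : forall x, f x \in submod_pred p.
Definition submod_lift_fun x : submod_type := Sub (f x) (f_in x).
Fact submod_lift_linear : linear submod_lift_fun.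
Proof. by move=> a x y; apply: val_inj; rewrite /= !linearP. Qed.
Definition submod_lift : {linear U -> submod_type} :=
  mk_linear submod_lift_linear.
End Corestriction.

End Submodules.

Section LinearAlgebra.
Variable S : pzRingType.
Implicit Types U V W P : lmodType S.

Fact ker_closed V W (f : {linear V -> W}) :
  submod_closed [pred x | f x == 0].
Proof.
split=> [|a x y]; rewrite !inE ?linear0 // => /eqP fx /eqP fy.
by rewrite linearP fx fy scaler0 addr0.
Qed.
Definition ker_submod V W (f : {linear V -> W}) := Submodule (ker_closed f).

Fact image_closed V W (f : {linear V -> W}) :
  submod_closed [pred y | `[< exists x, y = f x >]].
Proof.
split=> [|a x y]; rewrite !inE; first by apply/asboolP; exists 0;
  rewrite linear0.
move=> /asboolP[u ->] /asboolP[v ->]; apply/asboolP.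
by exists (a *: u + v); rewrite linearP.
Qed.
Definition image_submod V W (f : {linear V -> W}) := Submodule (image_closed f).

(** Replacing [V] by the image of [g] makes [g] onto, as [projective_module] requires. *)
Lemma projective_lift P U V (g : {linear U -> V}) (f : {linear P -> V}) :
  projective_module P -> (forall x, exists y, f x = g y) ->
  exists h : {linear P -> U}, forall x, g (h x) = f x.
Proof.
move=> projP fg.
have gI x : g x \in image_submod g by rewrite inE; apply/asboolP; exists x.
have fI x : f x \in image_submod g by rewrite inE; apply/asboolP/fg.
have [|h gh] := projP _ _ (submod_lift gI) (submod_lift fI).
  move=> [z zI]; have /asboolP[x zx] := zI; exists x.
  exact: val_inj.
by exists h => x; have /(congr1 val) := gh x.
Qed.

Lemma injective_lift U V W (g : {linear V -> W}) (f : {linear U -> W}) :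
  injective g -> (forall x, exists y, f x = g y) ->
  exists h : {linear U -> V}, forall x, g (h x) = f x.
Proof.
move=> g_inj /choice[h gh].
have h_lin : linear h by move=> a x y; apply: g_inj; rewrite -gh !linearP -!gh.
by exists (mk_linear h_lin) => x; rewrite /= -gh.
Qed.

Lemma linear_inverse U V (f : {linear U -> V}) :
  injective f -> (forall y, exists x, f x = y) ->
  exists g : {linear V -> U}, cancel f g /\ cancel g f.
Proof.
move=> f_inj f_sur.
have [|g fg] := @injective_lift _ _ _ f (id_linear V) f_inj.
  by move=> y; have [x <-] := f_sur y; exists x.
by exists g; split=> x; [apply: f_inj; rewrite fg | rewrite fg].
Qed.

Lemma fin_gen_image U V (f : {linear U -> V}) :
  fin_gen U -> (forall y, exists x, f x = y) -> fin_gen V.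
Proof.
move=> [n [v v_gen]] f_sur; exists n, (fun i => f (v i)) => y.
have [x <-] := f_sur y; have [a ->] := v_gen x; exists a.
by rewrite linear_sum; apply: eq_bigr => i _; rewrite linearZ.
Qed.

End LinearAlgebra.

(** * Complexes up to homotopy *)

Section DependentFamilies.
Variable T : int -> Type.

(** Components extracted from a homotopy live in degree [i + 1]. Every integer is a successor only
    up to a propositional equality, so reading them as a family over all degrees takes a transport,
    confined to this lemma. *)
Lemma succ_family (f : forall i, T (i + 1)) :
  exists g : forall i, T i, forall i, g (i + 1) = f i.
Proof.
exists (fun i => ecast j (T j) (subrK 1 i) (f (i - 1))) => i.
(* Once the equality proof is generalized, [i + 1 - 1] can be rewritten to [i]; the transport is
   then along a loop in [int], hence trivial. *)
move: (subrK 1 (i + 1)); rewrite -[X in forall e : _ = X, _]/(i + 1).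
have -> : i + 1 - 1 = i by rewrite addrK.
by move=> e; rewrite (eq_irrelevance e erefl).
Qed.

Lemma update_family (f : forall i, T i) i0 (y : T i0) :
  exists g : forall i, T i, g i0 = y /\ forall i, i != i0 -> g i = f i.
Proof.
exists (dfwith f y); split=> [|i]; first by rewrite dfwith_in.
by rewrite eq_sym => ?; rewrite dfwith_out.
Qed.

End DependentFamilies.

Section Complexes.
Variable S : pzRingType.
Implicit Types X Y Z P : complex S.

Definition projective_complex P := forall i, projective_module (P i).

Definition acyclic X := forall i (x : X (i + 1)),
  cd X (i + 1) x = 0 -> exists y : X i, x = cd X i y.

(** [P] is bounded above, so the homotopy is built downwards. The equation one degree higher makes
    [f - h d] a cycle, hence a boundary, and projectivity lifts it through the differential of
    [X]. *)
Lemma projective_acyclic_homotopy P X (f : chain_map P X) :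
  projective_complex P -> acyclic X ->
  exists h : forall i, {linear P (i + 1) -> X i},
    forall i x, f (i + 1) x = cd X i (h i x) + h (i + 1) (cd P (i + 1) x).
Proof.
move=> projP acX; have [n Pn] := cbound P.
pose eqn (h : forall i, {linear P (i + 1) -> X i}) i :=
  forall x, f (i + 1) x = cd X i (h i x) + h (i + 1) (cd P (i + 1) x).
suff H k : exists h, forall i, n - k%:Z < i -> eqn h i.
  (* At or below [n - (2|n| + 2)] the degree [i + 1] is less than [- n], where [P] vanishes and any
     homotopy works. *)
  have [h hP] := H (`|n|%N * 2 + 2)%N; exists h => i x.
  case: (boolP (n - (`|n|%N * 2 + 2)%N%:Z < i)) => [/hP->//|ni].
  by rewrite (Pn _ _ x) ?linear0 ?addr0 //; lia.
elim: k => [|k [h hP]].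
  exists (fun i => zero_linear (P (i + 1)) (X i)) => i ni x.
  by rewrite (Pn _ _ x) ?linear0 ?addr0 //; lia.
pose i0 := n - k%:Z.
pose r := add_linear (f (i0 + 1))
  (opp_linear (comp_linear (h (i0 + 1)) (cd P (i0 + 1)))).
have [|u uP] := @projective_lift _ _ _ _ (cd X i0) r (projP _).
  move=> x; apply: acX; rewrite /= linearB /= -cmapd.
  by rewrite hP ?cdd ?linear0 ?addr0 ?subrr //; rewrite /i0; lia.
have [h' [h'0 h'P]] := update_family h u; exists h' => i ni.
have [->|i_neq] := eqVneq i i0; move=> x.
  by rewrite h'0 h'P 1?uP /= ?subrK //; lia.
by rewrite !h'P ?hP //; rewrite /i0 in i_neq *; lia.
Qed.

End Complexes.

(* Proves identities between Z-linear combinations in an abelian group: the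
   difference of both sides is expanded and its last summand cancelled until
   nothing is left. *)
Ltac zmod_cancel s t :=
  lazymatch s with
  | ?a + ?b =>
      first [ lazymatch b with - ?c => unify c t; rewrite (subrK c a) end
            | lazymatch t with - ?c => unify c b; rewrite (addrK c a) end
            | rewrite (addrAC a b t); zmod_cancel a t ]
  | - ?c => unify c t; rewrite (addNr c)
  | _ => lazymatch t with - ?c => unify c s; rewrite (subrr c) end
  end.
Ltac zmod :=
  apply/eqP; rewrite -subr_eq0;
  rewrite ?(opprD, opprK, oppr0, addr0, add0r, addrA); apply/eqP;
  repeat (lazymatch goal with
          | |- ?s + ?t = 0 => zmod_cancel s t
          end; rewrite ?(add0r, addr0)); reflexivity.

Section Cones.
Variable S : pzRingType.
Implicit Types X Y Z P : complex S.

Lemma succ_ind (Q : int -> Prop) :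
  (forall i, Q (i + 1)) -> forall i, Q i.
Proof. by move=> HQ i; rewrite -(subrK 1 i). Qed.

Lemma pair_eq (U V : lmodType S) (u u' : U) (v v' : V) :
  (u, v) = (u', v') -> u = u' /\ v = v'.
Proof. by case. Qed.

(** For a cycle (y, z) of the cone, injectivity on cohomology writes [y] as [d x']; then [z + s x']
    is a cycle, and surjectivity represents it by a cycle of [X] up to a boundary. *)
Lemma quasi_iso_acyclic X Y (s : chain_map X Y) :
  @quasi_iso S X Y s -> acyclic (cone s).
Proof.
move=> qs i [/= y z] /pair_eq[/= /eqP]; rewrite oppr_eq0 => /eqP dy E.
have [|x' yE] := (qs (i + 1)).1 y dy.
  by exists (- z); apply/eqP; rewrite linearN -addr_eq0 E.
have [|w [dw [z' E']]] := (qs i).2 (z + s _ x').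
  by rewrite linearD -cmapd -yE [LHS]addrC.
exists (w - x', z'); congr (_, _) => /=.
  by rewrite linearB dw -yE; zmod.
by rewrite linearB /= addrAC -E' addrK.
Qed.

Lemma quasi_iso_comp X Y Z (g : chain_map Y Z) (f : chain_map X Y) :
  @quasi_iso S Y Z g -> @quasi_iso S X Y f ->
  @quasi_iso S X Z (chain_comp g f).
Proof.
move=> qg qf i; have [inj_g sur_g] := qg i; have [inj_f sur_f] := qf i.
split=> [x dx gfx|z].
  by apply: inj_f => //; apply: inj_g => //; rewrite -cmapd dx linear0.
move=> /sur_g[y [/sur_f[x [dx [y' ->]]] [z' ->]]].
exists x; split=> //; exists (g i y' + z').
by rewrite !linearD cmapd; zmod.
Qed.

Lemma quasi_iso_bij X Y (f : chain_map X Y) :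
  (forall i, injective (f i)) -> (forall i y, exists x, f i x = y) ->
  @quasi_iso S X Y f.
Proof.
move=> f_inj f_sur i; split=> [x dx [y fx]|y dy].
  by have [x' E] := f_sur _ y; exists x'; apply: (f_inj (i + 1));
    rewrite cmapd E.
have [x E] := f_sur _ y; exists x; split.
  by apply: (f_inj (i + 1 + 1)); rewrite cmapd E dy linear0.
by exists 0; rewrite linear0 addr0.
Qed.

Section ConeMap.
Variables (X Y X' Y' : complex S) (f : chain_map X Y) (f' : chain_map X' Y').
Variables (a : chain_map X X') (b : chain_map Y Y').
Variable h : forall i, {linear X (i + 1) -> Y' i}.
Hypothesis hP : forall i x,
  b (i + 1) (f (i + 1) x) - f' (i + 1) (a (i + 1) x) =
  cd Y' i (h i x) + h (i + 1) (cd X (i + 1) x).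

(** The square from [f] to [f'] commutes only up to [h]; as off-diagonal entry, [h] restores
    compatibility with the differentials. *)
Definition cone_map_fun i (p : cone f i) : cone f' i :=
  (a (i + 1) p.1, b i p.2 + h i p.1).
Fact cone_map_linear i : linear (@cone_map_fun i).
Proof.
by move=> r p q; congr (_, _); rewrite /= !linearP //= scalerDr; zmod.
Qed.
Fact cone_map_chain i (p : cone f i) :
  mk_linear (@cone_map_linear (i + 1)) (cd (cone f) i p) =
  cd (cone f') i (mk_linear (@cone_map_linear i) p).
Proof.
case: p => x y; congr (_, _); rewrite /= !linearN ?cmapd //.
rewrite !linearD /= -cmapd.
have /eqP := hP x; rewrite subr_eq => /eqP ->; zmod.
Qed.
Definition cone_map : chain_map (cone f) (cone f') := ChainMap cone_map_chain.

(** The five lemma for the long exact sequences of the two cones, as an element chase. *)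
Lemma cone_map_quasi_iso :
  @quasi_iso S X X' a -> @quasi_iso S Y Y' b ->
  @quasi_iso S (cone f) (cone f') cone_map.
Proof.
have bf i x : b (i + 1) (f (i + 1) x) = f' (i + 1) (a (i + 1) x) +
    (cd Y' i (h i x) + h (i + 1) (cd X (i + 1) x)).
  by rewrite -hP; zmod.
move=> qa qb i; split.
  move=> [/= x y] /pair_eq[/= /eqP]; rewrite oppr_eq0 => /eqP dx E1.
  move=> [[x' y'] /pair_eq[/= E2 E3]].
  (* Injectivity: [x] bounds some [x1], and the cycle [x' + a x1] is represented by a cycle [x3] of
     [X]. Correcting [x1] by [x3] turns the second component into a cycle whose image under [b] is a
     boundary. *)
  have [|x1 xE] := (qa (i + 1)).1 x dx.
    by exists (- x'); rewrite linearN.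
  have [|x3 [dx3 [x4 x3E]]] := (qa i).2 (x' + a _ x1).
    by rewrite linearD -cmapd -xE E2 addrN.
  have [||y6 y6E] := (qb i).1 (y + f _ x1 - f _ x3).
  - by rewrite linearB linearD -!cmapd -xE dx3 linear0 subr0 [LHS]addrC.
  - exists (y' + h i x1 + f' i x4 - h i x3).
    have x'E : x' = a (i + 1) x3 + cd X' i x4 - a (i + 1) x1.
      by rewrite -x3E addrK.
    have byE : b (i + 1) y = f' (i + 1) x' + cd Y' i y' - h (i + 1) x.
      by rewrite -E3; zmod.
    rewrite !(linearB, linearD) /= !bf dx3 -xE byE x'E !(linearB, linearD) /=.
    by rewrite linear0 -cmapd; zmod.
  exists (x3 - x1, y6); congr (_, _) => /=.
    by rewrite linearB dx3 xE; zmod.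
  by rewrite linearB -y6E; zmod.
move=> [/= x' y'] /pair_eq[/= /eqP]; rewrite oppr_eq0 => /eqP dx' E1.
(* Surjectivity: [x] represents the class of [x'], and [f x] bounds [y0] because its image under [b]
   is a boundary. The second component, corrected by [b y0], is then a cycle and can be lifted. *)
have [x [dx [u x'E]]] := (qa (i + 1)).2 x' dx'.
have dy'E : cd Y' _ y' = - f' _ x'.
  by apply/eqP; rewrite -addr_eq0 [X in X == _]addrC E1.
have [||y0 y0E] := (qb (i + 1)).1 (f _ x).
- by rewrite -cmapd dx linear0.
- exists (h _ x - f' _ u - y').
  rewrite bf dx !linearB /= linear0 -cmapd addr0.
  by rewrite dy'E x'E linearD; zmod.
have [|y1 [dy1 [v y1E]]] := (qb i).2 (y' + f' _ u - h _ x + b _ y0).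
  rewrite !(linearB, linearD) /= -!cmapd -y0E bf dx linear0 addr0.
  by rewrite dy'E x'E linearD; zmod.
exists (x, y1 - y0); split.
  congr (_, _) => /=; first by rewrite dx oppr0.
  by rewrite linearB dy1 y0E; zmod.
exists (- u, v); congr (_, _) => /=.
  by rewrite linearN x'E; zmod.
rewrite linearB linearN /=.
have -> : b (i + 1) y1 = y' + f' (i + 1) u - h (i + 1) x + b (i + 1) y0 -
    cd Y' i v by rewrite y1E addrK.
by zmod.
Qed.
End ConeMap.

Definition lfst (U V : lmodType S) : {linear (U * V)%type -> U} := fst.
Definition lsnd (U V : lmodType S) : {linear (U * V)%type -> V} := snd.

(** The composite of [f] with the inclusion of [Z] in the cone of [s] is null-homotopic. The first
    component of the null-homotopy is the lift, and minus the second is the homotopy from [s g] to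
    [f]. *)
Lemma projective_quasi_iso_lift P Y Z (s : chain_map Y Z) (f : chain_map P Z) :
  projective_complex P -> @quasi_iso S Y Z s ->
  exists g : chain_map P Y, homotopic (chain_comp s g) f.
Proof.
move=> projP qs.
have [h hP] := projective_acyclic_homotopy (chain_comp (cone_inj s) f) projP
  (quasi_iso_acyclic qs).
have [g gE] := succ_family (T := fun i => {linear P i -> Y i})
  (fun i => comp_linear (lfst _ _) (h i)).
have g_chain : forall i x, g (i + 1) (cd P i x) = cd Y i (g i x).
  apply: succ_ind => i x; rewrite !gE /=.
  have [/= E _] := pair_eq (hP i x).
  by apply/eqP; rewrite -subr_eq0 [X in X == _]addrC -E.
exists (ChainMap g_chain), (fun i => opp_linear (comp_linear (lsnd _ _) (h i))).
move=> i x; have [_ /= ->] := pair_eq (hP i x).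
by rewrite gE /= linearN; zmod.
Qed.

(** A homotopy [k] between [s g] and [s g'] makes (g - g', - k) a chain map from the shift of [P] to
    the acyclic cone of [s]. Up to sign, the first component of a null-homotopy of it is a homotopy
    from [g] to [g']. *)
Lemma projective_quasi_iso_inj P Y Z (s : chain_map Y Z)
    (g g' : chain_map P Y) :
  projective_complex P -> @quasi_iso S Y Z s ->
  homotopic (chain_comp s g) (chain_comp s g') -> homotopic g g'.
Proof.
move=> projP qs [k kP].
pose F_fun i (x : P (i + 1)) : cone s i := (g _ x - g' _ x, - k i x).
have F_lin i : linear (@F_fun i).
  move=> a x y; congr (_, _); rewrite /=.
    by rewrite (linearP (g _)) (linearP (g' _)) scalerBr; zmod.
  by rewrite (linearP (k i)) scalerN; zmod.
have F_chain i (x : cshift P i) : mk_linear (F_lin (i + 1)) (cd (cshift P) i x)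
  =
    cd (cone s) i (mk_linear (F_lin i) x).
  congr (_, _); rewrite /= !linearN ?linearB /= -?cmapd; first by zmod.
  by have /= := kP _ x; move/eqP; rewrite subr_eq => /eqP ->; zmod.
have [|h hP] := @projective_acyclic_homotopy S (cshift P) _ (ChainMap F_chain) _
  (quasi_iso_acyclic qs).
  by move=> i; apply: projP.
have [H HE] := succ_family (T := fun i => {linear P (i + 1) -> Y i})
  (fun i => opp_linear (comp_linear (lfst _ _) (h i))).
exists H; apply: succ_ind => i x; rewrite !HE /=.
have [/= -> _] := pair_eq (hP i x).
by rewrite !linearN /=; zmod.
Qed.

End Cones.

(** * Corner rings *)

Lemma fin_gen_finType (S : pzRingType) (M : lmodType S) (I : finType)
    (v : I -> M) :
  (forall x, exists a : I -> S, x = \sum_i a i *: v i) -> fin_gen M.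
Proof.
move=> v_gen; exists #|I|, (fun j => v (enum_val j)) => x.
have [a ->] := v_gen x; exists (fun j => a (enum_val j)).
by rewrite -(big_enum_val (fun i => a i *: v i)).
Qed.

Lemma levelwise_iso (S : pzRingType) (X Y : Kb S) (f : chain_map X Y) :
  (forall i, injective (f i)) -> (forall i y, exists x, f i x = y) ->
  @is_iso (Kb S) X Y f.
Proof.
move=> f_inj f_sur.
pose G i := cid (linear_inverse (@f_inj i) (f_sur i)).
pose g i := projT1 (G i); have gP i := projT2 (G i).
have g_chain i (y : cmod Y i) : g (i + 1) (cd Y i y) = cd X i (g i y).
  by apply: (f_inj (i + 1)); rewrite cmapd !(gP _).2.
by exists (ChainMap g_chain); split; apply: homotopic_ext => i x /=;
  [apply: (gP _).1 | apply: (gP _).2].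
Qed.

(* An identification of [S] with the corner ring [e * S' * e], [e = c 1]. *)
Record corner (S S' : pzRingType) := Corner {
  cor :> {additive S -> S'};
  corM : {morph cor : a b / a * b};
  cor_inj : injective cor;
  cor_onto : forall b, exists a, cor 1 * b * cor 1 = cor a;
  cor_fg : exists (n : nat) (w : 'I_n -> S'),
    forall b, exists a : 'I_n -> S, cor 1 * b = \sum_i cor (a i) * w i
}.

Section CornerModules.
Variables (S S' : pzRingType) (c : corner S S').
Implicit Types M N Q : lmodType S'.

Lemma cor1l a : c 1 * c a = c a.
Proof. by rewrite -corM mul1r. Qed.
Lemma cor1r a : c a * c 1 = c a.
Proof. by rewrite -corM mulr1. Qed.

(** For the idempotent [e = c 1], the corner e N is the set of fixed points of [e]; over converse
    rings this is the N e of right modules. *)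
Definition corner_pred N : {pred N} := [pred x | c 1 *: x == x].

Fact corner_zmod_closed N : zmod_closed (@corner_pred N).
Proof.
split=> [|x y]; rewrite !inE ?scaler0 // => /eqP ex /eqP ey.
by rewrite scalerBr ex ey.
Qed.
HB.instance Definition _ N :=
  GRing.isZmodClosed.Build N (@corner_pred N) (corner_zmod_closed N).

Definition corner_mod N := {x : N | x \in @corner_pred N}.
HB.instance Definition _ N := SubChoice.on (corner_mod N).
HB.instance Definition _ N := [SubChoice_isSubZmodule of corner_mod N by <:].

Lemma corner_modP N (x : corner_mod N) : c 1 *: val x = val x.
Proof. by apply/eqP; have := valP x; rewrite inE. Qed.

Fact corner_scale_in N a (x : N) : c a *: x \in @corner_pred N.
Proof. by rewrite inE scalerA cor1l. Qed.
Definition corner_scale N a (x : corner_mod N) : corner_mod N :=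
  Sub (c a *: val x) (corner_scale_in a (val x)).

Fact corner_scaleA N a b (x : corner_mod N) :
  corner_scale a (corner_scale b x) = corner_scale (a * b) x.
Proof. by apply: val_inj; rewrite /= scalerA -corM. Qed.
Fact corner_scale1 N : left_id 1 (@corner_scale N).
Proof. by move=> x; apply: val_inj; rewrite /= corner_modP. Qed.
Fact corner_scaleDr N : right_distributive (@corner_scale N) +%R.
Proof. by move=> a x y; apply: val_inj; rewrite /= scalerDr. Qed.
Fact corner_scaleDl N (x : corner_mod N) :
  {morph (@corner_scale N)^~ x : a b / a + b}.
Proof. by move=> a b; apply: val_inj; rewrite /= raddfD scalerDl. Qed.
HB.instance Definition _ N := GRing.Zmodule_isLmodule.Build S (corner_mod N)
  (@corner_scaleA N) (@corner_scale1 N) (@corner_scaleDr N) (@corner_scaleDl N).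

Definition corner_proj N (x : N) : corner_mod N :=
  Sub (c 1 *: x) (corner_scale_in 1 x).

Lemma corner_projK N (x : corner_mod N) : corner_proj (val x) = x.
Proof. by apply: val_inj; rewrite /= corner_modP. Qed.

Section Map.
Variables (N N' : lmodType S') (f : {linear N -> N'}).
Fact corner_map_in (x : corner_mod N) : f (val x) \in @corner_pred N'.
Proof. by rewrite inE -linearZ corner_modP. Qed.
Fact corner_map_linear :
  linear (fun x : corner_mod N => Sub (f (val x)) (corner_map_in x) :
    corner_mod N').
Proof. by move=> a x y; apply: val_inj; rewrite /= linearP. Qed.
Definition corner_map : {linear corner_mod N -> corner_mod N'} :=
  mk_linear corner_map_linear.
Lemma corner_map_proj x : corner_map (corner_proj x) = corner_proj (f x).
Proof. by apply: val_inj; rewrite /= linearZ. Qed.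
End Map.

(** If the [v i] generate [N] and the [w j] generate [c 1 * S'] over [S], as in [cor_fg], then the
    [c 1 *: (w j *: v i)] generate the corner. *)
Lemma corner_fg N : fin_gen N -> fin_gen (corner_mod N : lmodType S).
Proof.
move=> [m [v v_gen]]; have [n [w w_gen]] := cor_fg c.
apply: (@fin_gen_finType _ _ ('I_m * 'I_n)%type
  (fun ij => corner_proj (w ij.2 *: v ij.1))) => x.
have [b xE] := v_gen (val x).
have [a aE] := choice (fun i => w_gen (b i)).
exists (fun ij => a ij.1 ij.2); apply: val_inj.
rewrite -corner_modP xE scaler_sumr raddf_sum /=.
rewrite -(pair_bigA _ (fun i j => c (a i j) *: (c 1 *: (w j *: v i)))) /=.
apply: eq_bigr => i _; rewrite scalerA aE scaler_suml.
by apply: eq_bigr => j _; rewrite !scalerA cor1r.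
Qed.

(* Equivalently, [Q] is a direct summand of a finite power of [S' * c 1]: the
   [b i] and [q i] form a dual basis with the [q i] fixed by [c 1]. *)
Definition good Q := exists (n : nat) (q : 'I_n -> corner_mod Q)
    (b : 'I_n -> {linear Q -> S'^o}),
  forall x, x = \sum_i (b i x : S') *: (val (q i) : Q).

Lemma good_fin_gen Q : good Q -> fin_gen Q.
Proof. by move=> [n [q [b xE]]]; exists n, (fun i => val (q i)) => x;
  exists (fun i => b i x). Qed.

Lemma good_prod Q Q' : good Q -> good Q' -> good (Q * Q')%type.
Proof.
move=> [n [q [b xE]]] [n' [q' [b' xE']]].
have q1P i : (val (q i), 0) \in @corner_pred (Q * Q')%type.
  by rewrite inE; apply/eqP; congr (_, _); rewrite /= ?scaler0 ?corner_modP.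
have q2P i : (0, val (q' i)) \in @corner_pred (Q * Q')%type.
  by rewrite inE; apply/eqP; congr (_, _); rewrite /= ?scaler0 ?corner_modP.
exists (n + n')%N, (fun i => match split i with
  | inl j => Sub (val (q j), 0) (q1P j) | inr j => Sub (0,
    val (q' j)) (q2P j) end),
  (fun i => match split i with
  | inl j => comp_linear (b j) (lfst _ _) | inr j =>
    comp_linear (b' j) (lsnd _ _) end).
move=> [x x']; rewrite big_split_ord /=.
under eq_bigr => j _ do rewrite (unsplitK (inl _ j : 'I_n + 'I_n')).
under [X in _ = _ + X]eq_bigr => j _ do
  rewrite (unsplitK (inr _ j : 'I_n + 'I_n')).
rewrite {1}(xE x) {1}(xE' x') [RHS]surjective_pairing /=; congr (_, _).
  rewrite !raddf_sum /= [X in _ = _ + X]big1 ?addr0 // => j _.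
  exact: scaler0.
rewrite !raddf_sum /= [X in _ = X + _]big1 ?add0r // => j _.
exact: scaler0.
Qed.

(** As [x] is fixed by [c 1], the element [b x * c 1] lies in the corner ring. The factor [c 1] is
    harmless when the coefficient acts on elements fixed by [c 1]. *)
Lemma corner_coef Q (b : {linear Q -> S'^o}) :
  exists a : {linear corner_mod Q -> S^o}, forall x, c (a x) = b (val x) * c 1.
Proof.
have /choice[a aE] (x : corner_mod Q) : exists a, c a = b (val x) * c 1.
  have [a aE] := cor_onto c (b (val x)); exists a.
  by rewrite -aE -[in RHS]corner_modP linearZ.
have a_lin : linear (a : corner_mod Q -> S^o).
  move=> r x y; apply: (cor_inj (c := c)).
  by rewrite raddfD /= corM !aE linearP /= mulrDl mulrA.
by exists (mk_linear a_lin).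
Qed.

Lemma good_coef Q : good Q ->
  exists (n : nat) (q : 'I_n -> corner_mod Q)
    (a : 'I_n -> {linear corner_mod Q -> S^o}), forall x, x = \sum_i (a i x :
      S) *: q i.
Proof.
move=> [n [q [b xE]]]; have /choice[a aE] i := corner_coef (b i).
exists n, q, a => x; apply: val_inj; rewrite {1}[val x]xE raddf_sum /=.
by apply: eq_bigr => i _; rewrite aE -scalerA corner_modP.
Qed.

Lemma good_projective Q : good Q -> projective_module (corner_mod Q :
  lmodType S).
Proof.
move=> /good_coef[n [q [a xE]]] U V p f p_sur.
have /choice[u uE] i := p_sur (f (q i)).
have g_lin : linear (fun x => \sum_i (a i x : S) *: u i).
  move=> r x y; rewrite scaler_sumr -big_split /=; apply: eq_bigr => i _.
  by rewrite linearP scalerDl scalerA.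
exists (mk_linear g_lin) => x; rewrite {2}[x]xE !linear_sum /=.
by apply: eq_bigr => i _; rewrite !linearZ -uE.
Qed.

(** With [e = c 1], this and [good_faithful] extend Hom(S' e, N) = e N to summands of powers of S'
    e: a map out of [Q] is determined by the images of the [q i], which lie in the corner. *)
Lemma good_full Q N (h : {linear corner_mod Q -> corner_mod N}) :
  good Q -> exists H : {linear Q -> N}, forall x, corner_map H x = h x.
Proof.
move=> [n [q [b xE]]].
have H_lin : linear (fun x => \sum_i (b i x : S') *: (val (h (q i)) : N)).
  move=> r x y; rewrite scaler_sumr -big_split /=; apply: eq_bigr => i _.
  by rewrite linearP scalerDl scalerA.
exists (mk_linear H_lin) => x; apply: val_inj => /=.
have /choice[a aE] i := corner_coef (b i).
have {2}-> : x = \sum_i (a i x : S) *: q i.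
  apply: val_inj; rewrite {1}[val x]xE raddf_sum /=.
  by apply: eq_bigr => i _; rewrite aE -scalerA corner_modP.
rewrite linear_sum -[RHS]/(val (\sum_i h ((a i x : S) *: q i))) raddf_sum.
apply: eq_bigr => i _.
by rewrite linearZ -[RHS]/(c (a i x) *: val (h (q i))) aE -scalerA corner_modP.
Qed.

Lemma good_faithful Q N (H H' : {linear Q -> N}) : good Q ->
  (forall x, corner_map H x = corner_map H' x) -> forall x, H x = H' x.
Proof.
move=> [n [q [b xE]]] HH' x; rewrite [x]xE !linear_sum.
apply: eq_bigr => i _; rewrite !linearZ; congr (_ *: _).
exact: (congr1 val (HH' (q i))).
Qed.

End CornerModules.

Section ProjectiveLifting.
Variables (S S' : pzRingType) (c : corner S S').

(* A projective [M] is the image of an idempotent matrix over [S]; the same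
   matrix, read in [S'], has the required image. *)
Lemma good_cover (M : lmodType S) : fin_gen M -> projective_module M ->
  exists Q : lmodType S', good c Q /\
    exists f : {linear corner_mod c Q -> M},
      injective f /\ forall y, exists x, f x = y.
Proof.
move=> [n [m m_gen]] projM.
have g_lin : linear (fun v : 'rV[S]_n => \sum_i v 0 i *: m i).
  move=> r v w; rewrite scaler_sumr -big_split /=; apply: eq_bigr => i _.
  by rewrite !mxE scalerDl scalerA.
have [|s sK] := projective_lift (g := mk_linear g_lin) (f := id_linear M) projM.
  move=> x; have [a ->] := m_gen x; exists (\row_i a i) => /=.
  by apply: eq_bigr => i _; rewrite mxE.
rewrite /= in sK.
(* The matrix of the idempotent [s g] of the free module, acting on row vectors; [s] identifies [M]
   with the vectors fixed by [E]. *)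
pose E := \matrix_(i, j) s (m i) 0 j.
have sE x : s x *m E = s x.
  rewrite -[in RHS](sK x) linear_sum mulmx_sum_row; apply: eq_bigr => i _.
  by rewrite linearZ; congr (_ *: _); apply/rowP => j; rewrite !mxE.
pose E' := map_mx c E.
have cM p (A : 'M_(p, n)) : map_mx c A *m E' = map_mx c (A *m E).
  apply/matrixP => i j; rewrite !mxE raddf_sum; apply: eq_bigr => k _.
  by rewrite !mxE corM.
have EE : E *m E = E.
  apply/row_matrixP => i; rewrite row_mul.
  have -> : row i E = s (m i) by apply/rowP => j; rewrite !mxE.
  exact: sE.
have Q_closed : submod_closed [pred v : 'rV[S']_n | v *m E' == v].
  split=> [|a v w]; rewrite !inE ?mul0mx // => /eqP vE /eqP wE.
  by rewrite mulmxDl -scalemxAl vE wE.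
pose Q := submod_type (Submodule Q_closed).
have qQ i : row i E' \in Submodule Q_closed.
  by rewrite inE -row_mul cM EE.
have qC i : Sub (row i E') (qQ i) \in @corner_pred _ _ c Q.
  rewrite inE; apply/eqP/val_inj/rowP => j.
  by rewrite /= !mxE cor1l.
exists Q; split.
  have b_lin i : linear (fun v : Q => val v 0 i : S'^o).
    by move=> a v w; rewrite /= !mxE.
  exists n, (fun i => Sub (Sub (row i E') (qQ i)) (qC i)).
  exists (fun i => mk_linear (b_lin i)) => v; apply: val_inj.
  have /eqP {1}<- := valP v; rewrite mulmx_sum_row raddf_sum.
  by apply: eq_bigr => i _.
have gQ x : map_mx c (s x) \in Submodule Q_closed.
  by rewrite inE cM sE.
have gC x : Sub (map_mx c (s x)) (gQ x) \in @corner_pred _ _ c Q.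
  by rewrite inE; apply/eqP/val_inj/rowP => j; rewrite /= !mxE cor1l.
pose G x : corner_mod c Q := Sub (Sub (map_mx c (s x)) (gQ x) : Q) (gC x).
have G_lin : linear G.
  move=> a x y; do 2!apply: val_inj; apply/rowP => j.
  by rewrite /= linearP !mxE raddfD corM.
have G_inj : injective (mk_linear G_lin).
  move=> x y /(congr1 (fun z => val (val z))) /= E0.
  rewrite -[x]sK -[y]sK; apply: eq_bigr => i _; congr (_ *: _).
  by have /rowP/(_ i) := E0; rewrite !mxE => /cor_inj.
have G_sur z : exists x, mk_linear G_lin x = z.
  (* The entries of [v] absorb [c 1] on the left since [z] is in the corner, and on the right since
     [v = v E'] and the entries of [E'] do. Hence they come from [S]. *)
  pose v : 'rV_n := val (val z).
  have vE : v *m E' = v by apply/eqP; have := valP (val z).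
  have cv i : c 1 * v 0 i = v 0 i.
    have /(congr1 (fun y : Q => val y 0 i)) /= := corner_modP z.
    by rewrite mxE.
  have vc i : v 0 i * c 1 = v 0 i.
    rewrite -vE mxE mulr_suml; apply: eq_bigr => j _.
    by rewrite -mulrA mxE cor1r.
  have /choice[a aE] i : exists a, c a = v 0 i.
    by have [a aE] := cor_onto c (v 0 i); exists a; rewrite -aE cv vc.
  exists (\sum_i a i *: m i); do 2!apply: val_inj => /=.
  have -> : s (\sum_i a i *: m i) = (\row_i a i) *m E.
    rewrite linear_sum mulmx_sum_row; apply: eq_bigr => i _.
    rewrite linearZ mxE; congr (_ *: _).
    by apply/rowP => j; rewrite !mxE.
  rewrite -cM -[RHS]vE; congr (_ *m _); apply/rowP => i.
  by rewrite !mxE aE.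
have [f [fK Kf]] := linear_inverse G_inj G_sur.
by exists f; split; [apply: can_inj Kf | move=> y; exists (mk_linear G_lin y)].
Qed.

End ProjectiveLifting.

(** * Corners of complexes, as a triangle functor fully faithful on maps out of good complexes *)

Section CornerComplexes.
Variables (S S' : pzRingType) (c : corner S S').
Implicit Types X Y Q : complex S'.

Fact corner_cdd X i (x : corner_mod c (X i)) :
  corner_map c (cd X (i + 1)) (corner_map c (cd X i) x) = 0.
Proof. by apply: val_inj; rewrite /= cdd. Qed.
Fact corner_cbound X : exists n : int,
  forall i, (n < i) || (i < - n) -> forall x : corner_mod c (X i), x = 0.
Proof.
by have [n Xn] := cbound X; exists n => i ni x; apply: val_inj; apply: Xn.
Qed.
Definition corner_complex X : complex S :=
  @Complex S (fun i => corner_mod c (X i)) (fun i => corner_map c (cd X i))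
    (fun i => corner_fg c (cfg X i)) (@corner_cdd X) (corner_cbound X).

Fact corner_cmapd X Y (f : chain_map X Y) i (x : corner_complex X i) :
  corner_map c (f (i + 1)) (cd (corner_complex X) i x) =
  cd (corner_complex Y) i (corner_map c (f i) x).
Proof. by apply: val_inj; rewrite /= cmapd. Qed.
Definition corner_chain X Y (f : chain_map X Y) :
    chain_map (corner_complex X) (corner_complex Y) :=
  @ChainMap _ (corner_complex X) (corner_complex Y)
    (fun i => corner_map c (f i)) (corner_cmapd f).

Lemma corner_homotopic X Y (f g : chain_map X Y) :
  homotopic f g -> homotopic (corner_chain f) (corner_chain g).
Proof.
case=> h fg; exists (fun i => corner_map c (h i)) => i x.
by apply: val_inj; rewrite /= fg.
Qed.

Fact corner_chain_id X :
  homotopic (corner_chain (chain_id X)) (chain_id (corner_complex X)).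
Proof. by apply: homotopic_ext => i x; apply: val_inj. Qed.
Fact corner_chain_comp X Y Z (g : chain_map Y Z) (f : chain_map X Y) :
  homotopic (corner_chain (chain_comp g f))
    (chain_comp (corner_chain g) (corner_chain f)).
Proof. by apply: homotopic_ext => i x; apply: val_inj. Qed.

Definition corner_functor : functor (Kb S') (Kb S) :=
  @Functor (Kb S') (Kb S) corner_complex corner_chain corner_homotopic
    corner_chain_id corner_chain_comp.

Lemma corner_quasi_iso X Y (f : chain_map X Y) :
  @quasi_iso S' X Y f ->
  @quasi_iso S (corner_complex X) (corner_complex Y) (corner_chain f).
Proof.
move=> qf i; have [inj_f sur_f] := qf i; split.
  move=> x /(congr1 val) /= dx [y /(congr1 val) /= fx].
  have [|x' xE] := inj_f (val x) dx; first by exists (val y).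
  exists (corner_proj c x'); apply: val_inj.
  by rewrite -corner_modP /= linearZ -xE.
move=> y /(congr1 val) /= /sur_f[x [dx [y' yE]]].
exists (corner_proj c x); split; first by apply: val_inj;
  rewrite /= linearZ /= dx scaler0.
exists (corner_proj c y'); apply: val_inj.
by rewrite -corner_modP /= yE scalerDr !linearZ.
Qed.

Fact corner_shift_chain X i (x : corner_complex (cshift X) i) :
  id_linear _ (cd (corner_complex (cshift X)) i x) =
  cd (cshift (corner_complex X)) i (id_linear (corner_mod c (X (i + 1))) x).
Proof. by apply: val_inj. Qed.
(** Both complexes have the same modules, but the sign of the shift is taken before restricting the
    differential on one side and after it on the other. *)
Definition corner_shift X :
    chain_map (corner_complex (cshift X)) (cshift (corner_complex X)) :=
  @ChainMap _ (corner_complex (cshift X)) (cshift (corner_complex X))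
    (fun i => id_linear (corner_mod c (X (i + 1)))) (corner_shift_chain (X :=
      X)).

Lemma corner_shift_iso X :
  @is_iso (Kb S) (corner_complex (cshift X)) (cshift (corner_complex X))
    (corner_shift X).
Proof. by apply: levelwise_iso => i // y; exists y. Qed.

Lemma corner_shift_nat (X Y : Kb S') (f : @hom (Kb S') X Y) :
  @heq (Kb S) _ _
    (chain_comp (corner_shift Y) (corner_chain (cshift_map f)))
    (chain_comp (cshift_map (corner_chain f)) (corner_shift X)).
Proof. by apply: homotopic_ext => i x; apply: val_inj. Qed.

Section Cone.
Variables (X Y : complex S') (f : chain_map X Y).
Definition corner_cone_fun i :
    corner_complex (cone f) i -> cone (corner_chain f) i :=
  fun z => (corner_map c (lfst (X (i + 1)) (Y i)) z,
            corner_map c (lsnd (X (i + 1)) (Y i)) z).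
Fact corner_cone_linear i : linear (@corner_cone_fun i).
Proof. by move=> a z w; congr (_, _); rewrite linearP. Qed.
Fact corner_cone_chain i (z : corner_complex (cone f) i) :
  mk_linear (@corner_cone_linear (i + 1)) (cd (corner_complex (cone f)) i z) =
  cd (cone (corner_chain f)) i (mk_linear (@corner_cone_linear i) z).
Proof. by congr (_, _); apply: val_inj. Qed.
Definition corner_cone :
    chain_map (corner_complex (cone f)) (cone (corner_chain f)) :=
  ChainMap corner_cone_chain.

Lemma corner_cone_inj i : injective (corner_cone i).
Proof.
move=> z w /pair_eq[/(congr1 val) /= E1 /(congr1 val) /= E2].
by apply: val_inj; rewrite [LHS]surjective_pairing E1 E2 -surjective_pairing.
Qed.

Lemma corner_cone_sur i z : exists w, corner_cone i w = z.
Proof.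
case: z => x y; exists (corner_proj c (val x,
  val y) :> corner_mod c (cone f i)).
by congr (_, _); apply: val_inj; rewrite /= corner_modP.
Qed.

Lemma corner_cone_triangle :
  triangle_iso
    (@triangle_image (Kb S') (Kb S) (shift (Kb S')) (shift (Kb S))
      corner_functor corner_shift (cone_triangle f))
    (cone_triangle (corner_chain f)).
Proof.
exists (idm _), (idm _), corner_cone; split; split.
- exact: iso_id.
- exact: iso_id.
- exact: levelwise_iso corner_cone_inj corner_cone_sur.
- by apply: homotopic_ext.
- by apply: homotopic_ext => i x; congr (_, _); apply: val_inj.
- by apply: homotopic_ext => i x; apply: val_inj.
Qed.
End Cone.

Lemma corner_dist (t : triangle (shift (Kb S'))) : dist t ->
  dist (@triangle_image (Kb S') (Kb S) (shift (Kb S')) (shift (Kb S))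
      corner_functor corner_shift t).
Proof.
case=> X [Y [f I0]]; have I := @triangle_image_iso (Kb S') (Kb S)
  (shift (Kb S')) (shift (Kb S)) corner_functor corner_shift corner_shift_nat
  _ _ I0.
exists (corner_complex X), (corner_complex Y), (corner_chain f).
exact: triangle_iso_trans I (corner_cone_triangle f).
Qed.

Definition corner_tri_functor : triangle_functor (Kb S') (Kb S) :=
  @TriFunctor (Kb S') (Kb S) corner_functor corner_shift corner_shift_iso
    corner_shift_nat corner_dist.

Definition good_complex Q := forall i, good c (Q i).

Lemma good_complex_projective Q :
  good_complex Q -> projective_complex (corner_complex Q).
Proof. by move=> goodQ i; apply: good_projective. Qed.

(** The components lift by [good_full], and [good_faithful] lets their compatibility with the
    differentials be tested on the corner. *)
Lemma good_complex_full Q Y (f : chain_map (corner_complex Q) (corner_complex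
  Y)) :
  good_complex Q -> exists g : chain_map Q Y, homotopic (corner_chain g) f.
Proof.
move=> goodQ; pose G i := cid (good_full (f i) (goodQ i)).
have g_chain i x : projT1 (G (i + 1)) (cd Q i x) = cd Y i (projT1 (G i) x).
  apply: (good_faithful (c := c) (Q := Q i) (N := Y (i + 1))
    (H := comp_linear (projT1 (G (i + 1))) (cd Q i))
    (H' := comp_linear (cd Y i) (projT1 (G i))) (goodQ i)) => {}x.
  transitivity (f (i + 1) (cd (corner_complex Q) i x)).
    by rewrite -(projT2 (G (i + 1))); apply: val_inj.
  by rewrite cmapd -(projT2 (G i)); apply: val_inj.
by exists (ChainMap g_chain); apply: homotopic_ext => i x; apply:
  (projT2 (G (i + 1)) x).
Qed.

Lemma good_complex_faithful Q Y (f g : chain_map Q Y) : good_complex Q ->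
  homotopic (corner_chain f) (corner_chain g) -> homotopic f g.
Proof.
move=> goodQ [h hP]; pose H i := cid (good_full (h i) (goodQ (i + 1))).
exists (fun i => projT1 (H i)) => i.
apply: (good_faithful (c := c) (Q := Q (i + 1)) (N := Y (i + 1))
  (H := add_linear (f (i + 1)) (opp_linear (g (i + 1))))
  (H' := add_linear (comp_linear (cd Y i) (projT1 (H i)))
    (comp_linear (projT1 (H (i + 1))) (cd Q (i + 1)))) (goodQ (i + 1))) => x.
have := hP i x; rewrite -(projT2 (H i)) -(projT2 (H (i + 1))) =>
  /(congr1 val) E.
by apply: val_inj; apply: E.
Qed.

(* Homotopy classes of maps out of a good complex see only the corner, and
   there they are blind to quasi-isomorphisms. *)
Lemma good_complex_lift Q Y (Z : complex S)
    (s : chain_map (corner_complex Y) Z) (f : chain_map (corner_complex Q) Z) :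
  good_complex Q -> @quasi_iso S (corner_complex Y) Z s ->
  exists g : chain_map Q Y, homotopic (chain_comp s (corner_chain g)) f.
Proof.
move=> goodQ qs; have projQ := good_complex_projective goodQ.
have [g0 g0P] := projective_quasi_iso_lift f projQ qs.
have [g gP] := good_complex_full g0 goodQ; exists g.
exact: homotopic_trans (homotopic_comp (homotopic_refl s) gP) g0P.
Qed.

Lemma good_complex_inj Q Y (Z : complex S)
    (s : chain_map (corner_complex Y) Z) (g g' : chain_map Q Y) :
  good_complex Q -> @quasi_iso S (corner_complex Y) Z s ->
  homotopic (chain_comp s (corner_chain g)) (chain_comp s (corner_chain g')) ->
  homotopic g g'.
Proof.
move=> goodQ qs E; apply: good_complex_faithful => //.
exact: projective_quasi_iso_inj (good_complex_projective goodQ) qs E.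
Qed.

End CornerComplexes.

(** * Resolutions *)

Section ProjectiveDimension.
Variable S : pzRingType.
Implicit Types M N K P : lmodType S.

Lemma free_projective n : projective_module 'rV[S]_n.
Proof.
move=> U V p f p_sur; have /choice[u uE] i := p_sur (f (delta_mx 0 i)).
have g_lin : linear (fun v : 'rV[S]_n => \sum_i v 0 i *: u i).
  move=> r v w; rewrite scaler_sumr -big_split /=; apply: eq_bigr => i _.
  by rewrite !mxE scalerDl scalerA.
exists (mk_linear g_lin) => x; rewrite {2}[x]row_sum_delta !linear_sum /=.
by apply: eq_bigr => i _; rewrite !linearZ -uE.
Qed.

Lemma free_cover M : fin_gen M ->
  exists n (g : {linear 'rV[S]_n -> M}), forall x, exists v, x = g v.
Proof.
move=> [n [m m_gen]]; exists n.
have g_lin : linear (fun v : 'rV[S]_n => \sum_i v 0 i *: m i).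
  move=> r v w; rewrite scaler_sumr -big_split /=; apply: eq_bigr => i _.
  by rewrite !mxE scalerDl scalerA.
exists (mk_linear g_lin) => x; have [a ->] := m_gen x;
  exists (\row_i a i) => /=.
by apply: eq_bigr => i _; rewrite mxE.
Qed.

Lemma free_fin_gen n : fin_gen ('rV[S]_n : lmodType S).
Proof.
exists n, (fun i => delta_mx 0 i) => x; exists (fun i => x 0 i).
exact: row_sum_delta.
Qed.

Definition left_noetherian := forall K M (f : {linear K -> M}),
  injective f -> fin_gen M -> fin_gen K.

Fixpoint fg_projdim_le (n : nat) M : Prop :=
  match n with
  | 0%N => projective_module M
  | n'.+1 => exists K P (f : {linear K -> P}) (g : {linear P -> M}),
      [/\ short_exact f g, projective_module P, fin_gen P, fin_gen K &
          fg_projdim_le n' K]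
  end.

(** [N] is a direct summand of [M + P] with [P] projective: the one-sided form of the relation
    between syzygies in Schanuel's lemma. *)
Definition stable_retract N M := exists (a : {linear N -> M})
  (b : {linear M -> N}) P (d : {linear N -> P}) (e : {linear P -> N}),
  projective_module P /\ forall x, x = b (a x) + e (d x).

Lemma stable_retract_refl M : stable_retract M M.
Proof.
exists (id_linear M), (id_linear M), 'rV[S]_0, (zero_linear _ _),
  (zero_linear _ _).
by split=> [|x]; [apply: free_projective | rewrite /= addr0].
Qed.

(* Stable retracts pass to syzygies, so the arbitrary resolution witnessing
   [projdim_le] can be traded for a finitely generated one. *)
Lemma stable_retract_projdim n M N : left_noetherian ->
  projdim_le n M -> stable_retract N M -> fin_gen N -> fg_projdim_le n N.
Proof.
move=> noeth; elim: n M N => [|n IH] M N /=.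
  move=> projM [a [b [P [d [e [projP E]]]]]] _ U V p f p_sur.
  have [u uE] := projM _ _ p (comp_linear f b) p_sur.
  have [v vE] := projP _ _ p (comp_linear f e) p_sur.
  exists (add_linear (comp_linear u a) (comp_linear v d)) => x.
  by rewrite /= linearD uE vE /= -linearD -E.
move=> [K [P1 [f1 [g1 [[f1_inj ex1 g1_sur] projP1 pdK]]]]].
move=> [a [b [P [d [e [projP E]]]]]] fgN.
have [m [g' g'_sur]] := free_cover fgN.
have projF : projective_module 'rV[S]_m by exact: free_projective.
pose K' := submod_type (ker_submod g'); pose j' := submod_val (ker_submod g').
have gj x : g' (j' x) = 0 by apply/eqP; have := submod_valP x.
have exj' x : g' x = 0 -> exists y, x = j' y.
  move=> /eqP gx; have xK : x \in ker_submod g' by [].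
  by exists (Sub x xK).
have fgK' : fin_gen K'.
  by apply: noeth (free_fin_gen m); apply:
    (@submod_val_inj _ _ (ker_submod g')).
exists K', 'rV[S]_m, j', g'; split=> //.
- split=> // [|x]; first exact: submod_val_inj.
  by split=> [/exj'|[y ->]].
- exact: free_fin_gen.
have [A1 A1E] := projF _ _ g1 (comp_linear a g') g1_sur.
have [B1 B1E] := projP1 _ _ g' (comp_linear b g1) g'_sur.
have [e' e'E] := projP _ _ g' e g'_sur.
rewrite /= in A1E B1E.
(* Applying [g'] gives [g' x - b (a (g' x)) - e (d (g' x)) = 0], so [r0] lands in [K']. On [K'] the
   last term vanishes, and the identity is [bK aK] plus the map [r] through the free module. *)
pose r0 x := x - B1 (A1 x) - e' (d (g' x)).
have r0_lin : linear r0.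
  by move=> s x y; rewrite /r0 !linearP /= !(scalerDr, scalerN); zmod.
have [|r rE] := @injective_lift _ _ _ _ j' (mk_linear r0_lin)
  (@submod_val_inj _ _ (ker_submod g')).
  move=> x; apply: exj'; rewrite /= /r0 !linearB /= B1E A1E e'E.
  by rewrite {1}[g' x]E; zmod.
have [|aK aKE] := @injective_lift _ _ _ _ f1 (comp_linear A1 j') f1_inj.
  by move=> x; apply/ex1; rewrite /= A1E gj linear0.
have [|bK bKE] := @injective_lift _ _ _ _ j' (comp_linear B1 f1)
  (@submod_val_inj _ _ (ker_submod g')).
  move=> x; apply: exj'; rewrite /= B1E; suff -> :
    g1 (f1 x) = 0 by rewrite linear0.
  by apply/ex1; exists x.
apply: (IH _ _ pdK) => //.
exists aK, bK, 'rV[S]_m, j', r; split=> // x.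
apply: (@submod_val_inj _ _ (ker_submod g')).
rewrite linearD -/j' bKE rE /= /r0 aKE /= gj !linear0.
by zmod.
Qed.

Lemma fg_projdim n M : left_noetherian ->
  projdim_le n M -> fin_gen M -> fg_projdim_le n M.
Proof. by move=> noeth pdM; apply: stable_retract_projdim (stable_retract_refl
  M). Qed.

End ProjectiveDimension.

Section DegreeRestriction.
Variable S : pzRingType.
Implicit Types M N : lmodType S.

Fact restr_closed (p : bool) M : submod_closed [pred x : M | p || (x == 0)].
Proof.
split=> [|a x y]; rewrite !inE ?eqxx ?orbT //.
by case: p => //= /eqP-> /eqP->; rewrite scaler0 addr0.
Qed.
Definition restr_submod p M := Submodule (@restr_closed p M).
(* A submodule in both cases, so that no type depends on the value of [p]. *)
Definition restr p M : lmodType S := submod_type (restr_submod p M).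
Definition restr_in p M : {linear restr p M -> M} := submod_val _.
Arguments restr_in {p M}.

Fact restr_out_in p M (x : M) : (if p then x else 0) \in restr_submod p M.
Proof. by rewrite inE; case: p; rewrite //= eqxx. Qed.
Fact restr_out_linear p M :
  linear (fun x : M => Sub (if p then x else 0) (restr_out_in p x) : restr p M).
Proof.
by move=> a x y; apply: val_inj; case: p => //=; rewrite scaler0 addr0.
Qed.
Definition restr_out p M : {linear M -> restr p M} :=
  mk_linear (@restr_out_linear p M).

Lemma restr_outE p M (x : M) : restr_in (restr_out p M x) = if p then x else 0.
Proof. by []. Qed.

Lemma restr_outK p M (x : M) :
  (~~ p -> x = 0) -> restr_in (restr_out p M x) = x.
Proof. by rewrite restr_outE; case: p => // ->. Qed.

Lemma restr_inj p M : injective (@restr_in p M).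
Proof. exact: submod_val_inj. Qed.

Lemma restr_inK p M (x : restr p M) : restr_out p M (restr_in x) = x.
Proof.
apply: restr_inj; rewrite restr_outE; case: p x => // x.
by apply/esym/eqP; exact: (submod_valP x).
Qed.

Lemma restr_in0 p M (x : restr p M) : ~~ p -> x = 0.
Proof.
move=> np; rewrite -[LHS]restr_inK; apply: restr_inj.
by rewrite restr_outE ifN // linear0.
Qed.

Lemma restr_fin_gen p M : fin_gen M -> fin_gen (restr p M).
Proof.
move=> fgM; apply: (fin_gen_image (f := restr_out p M) fgM) => x.
by exists (restr_in x); rewrite restr_inK.
Qed.

Section Single.
Variables (a : int) (M : lmodType S) (fgM : fin_gen M).
Fact single_bound : exists n : int, forall i, (n < i) || (i < - n) ->
  forall x : restr (i == a) M, x = 0.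
Proof.
exists `|a| => i ni x; apply: restr_in0; apply/eqP; lia.
Qed.
Definition single : complex S := @Complex S (fun i => restr (i == a) M)
  (fun i => zero_linear _ _) (fun i => restr_fin_gen _ fgM) (fun i x => erefl)
  single_bound.
End Single.

Section SingleMap.
Variables (a : int) (M N : lmodType S) (fgM : fin_gen M) (fgN : fin_gen N).
Variable f : {linear M -> N}.
Definition restr_map p : {linear restr p M -> restr p N} :=
  comp_linear (restr_out p N) (comp_linear f (@restr_in p M)).
Lemma restr_mapE p x : restr_in (restr_map p x) = f (restr_in x).
Proof.
apply: restr_outK => np; by rewrite [x]restr_in0 // !linear0.
Qed.
Fact single_map_chain i (x : single a fgM i) :
  restr_map (i + 1 == a) (cd (single a fgM) i x) =
  cd (single a fgN) i (restr_map (i == a) x).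
Proof. exact: linear0. Qed.
Definition single_map : chain_map (single a fgM) (single a fgN) :=
  @ChainMap _ (single a fgM) (single a fgN) (fun i => restr_map (i == a))
    single_map_chain.
End SingleMap.

End DegreeRestriction.
Arguments restr_in {S p M}.

(** * Good resolutions of cones and of one-term complexes *)

Section Resolutions.
Variables (S S' : pzRingType) (c : corner S S').
Implicit Types X Y Z : complex S.

Definition has_good_resolution X := exists Q : complex S', good_complex c Q /\
  exists s : chain_map (corner_complex c Q) X,
    @quasi_iso S (corner_complex c Q) X s.

Lemma good_resolution_quasi_iso X Y (f : chain_map X Y) :
  @quasi_iso S X Y f -> has_good_resolution X -> has_good_resolution Y.
Proof.
move=> qf [Q [gQ [s qs]]]; exists Q; split=> //; exists (chain_comp f s).
exact: quasi_iso_comp.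
Qed.

Lemma good_cone (Q Q' : complex S') (g : chain_map Q Q') :
  good_complex c Q -> good_complex c Q' -> good_complex c (cone g).
Proof. by move=> gQ gQ' i; apply: good_prod. Qed.

(** Besides resolving cones, [r] respects both maps of the cone triangle; this is what later makes
    resolution preserve distinguished triangles. *)
Lemma good_resolution_cone_map X Y (f : chain_map X Y) (QX QY : complex S')
    (s : chain_map (corner_complex c QX) X) (t :
      chain_map (corner_complex c QY) Y)
    (g : chain_map QX QY) :
  @quasi_iso S (corner_complex c QX) X s ->
    @quasi_iso S (corner_complex c QY) Y t ->
  homotopic (chain_comp t (corner_chain c g)) (chain_comp f s) ->
  exists r : chain_map (corner_complex c (cone g)) (cone f),
   [/\ @quasi_iso S (corner_complex c (cone g)) (cone f) r,
     homotopic (chain_comp r (corner_chain c (cone_inj g)))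
       (chain_comp (cone_inj f) t) &
     homotopic (chain_comp (cone_proj f) r) (chain_comp (cshift_map s)
       (chain_comp (corner_shift c QX) (corner_chain c (cone_proj g))))].
Proof.
move=> qs qt [h hP].
exists (chain_comp (cone_map (b := t) (f :=
  corner_chain c g) hP) (corner_cone c g)).
split.
- apply: quasi_iso_comp; first exact: cone_map_quasi_iso.
  by apply: quasi_iso_bij => i; [apply: corner_cone_inj | apply:
    corner_cone_sur].
- apply: homotopic_ext => i x; congr (_, _) => /=.
    by rewrite -[X in s _ X](_ : 0 = _) ?linear0 //; apply: val_inj.
  rewrite -[X in h _ X](_ : 0 = _) ?linear0 ?addr0; last exact: val_inj.
  by congr (t _ _); apply: val_inj.
- apply: homotopic_ext => i x /=; congr (s _ _); exact: val_inj.
Qed.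

Lemma good_resolution_cone X Y (f : chain_map X Y) :
  has_good_resolution X -> has_good_resolution Y ->
    has_good_resolution (cone f).
Proof.
move=> [QX [gX [s qs]]] [QY [gY [t qt]]].
have [g gP] := good_complex_lift (chain_comp f s) gX qt.
have [r [qr _ _]] := good_resolution_cone_map qs qt gP.
by exists (cone g); split; [apply: good_cone | exists r].
Qed.

Lemma good_retract (Q Q' : lmodType S') (j : {linear Q' -> Q})
    (r : {linear Q -> Q'}) :
  (forall x, r (j x) = x) -> good c Q -> good c Q'.
Proof.
move=> rj [n [q [b xE]]].
exists n, (fun i => corner_map c r (q i)), (fun i => comp_linear (b i) j) => x.
rewrite -{1}[x]rj {1}[j x]xE linear_sum; apply: eq_bigr => i _.
by rewrite linearZ.
Qed.

Lemma good_resolution_projective a (M : lmodType S) (fgM : fin_gen M) :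
  projective_module M -> has_good_resolution (single a fgM).
Proof.
move=> projM; have [Q [gQ [f [f_inj f_sur]]]] := good_cover c fgM projM.
exists (single a (good_fin_gen gQ)); split.
  by move=> i; apply: good_retract (@restr_inK _ _ _) gQ.
pose s i : {linear corner_mod c (restr (i == a) Q) -> restr (i == a) M} :=
  comp_linear (restr_out (i == a) M)
    (comp_linear f (corner_map c (@restr_in _ (i == a) Q))).
have sE i x : restr_in (s i x) = f (corner_map c (@restr_in _ _ _) x).
  apply: restr_outK => ia; have -> : x = 0 by apply: val_inj; apply: restr_in0.
  by rewrite !linear0.
have s_chain i (x : corner_complex c (single a (good_fin_gen gQ)) i) :
    s (i + 1) (cd (corner_complex c (single a (good_fin_gen gQ))) i x) =
    cd (single a fgM) i (s i x).
  have -> : cd (corner_complex c (single a (good_fin_gen gQ))) i x = 0.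
    exact: val_inj.
  exact: linear0.
exists (@ChainMap _ (corner_complex c (single a (good_fin_gen gQ))) (single a
  fgM)
  s s_chain).
apply: quasi_iso_bij => i.
  move=> x y /(congr1 (@restr_in _ _ _)); rewrite !sE => /f_inj/(congr1 val) E.
  by apply: val_inj; apply: restr_inj.
move=> y; have [x xE] := f_sur (restr_in y).
exists (corner_proj c (restr_out (i == a) Q (val x))).
apply: restr_inj; rewrite sE -xE corner_map_proj restr_outK ?corner_projK // =>
  ia.
by rewrite (_ : x = 0) //; apply: f_inj; rewrite xE [y]restr_in0 ?linear0.
Qed.

(** For 0 -> K -> P -> M -> 0, the cone of K -> P, both placed in degree [a], maps
    quasi-isomorphically to [M], and the induction hypothesis resolves [K]. *)
Lemma good_resolution_single a n (M : lmodType S) (fgM : fin_gen M) :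
  fg_projdim_le n M -> has_good_resolution (single a fgM).
Proof.
elim: n M fgM => [|n IH] M fgM; first exact: good_resolution_projective.
move=> [K [P [f [g [[f_inj ex g_sur] projP fgP fgK pdK]]]]].
pose F := single_map a fgK fgP f; pose G := single_map a fgP fgM g.
have gf x : g (f x) = 0 by apply/ex; exists x.
pose r_fun i (kp : cone F i) : single a fgM i := G i kp.2.
have r_lin i : linear (@r_fun i) by move=> s x y; rewrite /r_fun linearP.
have r_chain i (kp : cone F i) : mk_linear (r_lin (i + 1)) (cd (cone F) i kp) =
    cd (single a fgM) i (mk_linear (r_lin i) kp).
  case: kp => k p; rewrite /= /r_fun linearD linear0 addr0.
  by apply: restr_inj; rewrite !restr_mapE gf linear0.
apply: (good_resolution_quasi_iso (f := ChainMap r_chain)).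
  move=> i; split.
    move=> [k p] /pair_eq[_ E1] [y E2].
    have k0 : k = 0.
      apply: restr_inj; apply: f_inj; rewrite -restr_mapE.
      have -> : restr_map f _ k = 0 := etrans (esym (addr0 _)) E1.
      by rewrite !linear0.
    have /ex[k' pE] : g (restr_in p) = 0.
      rewrite -restr_mapE; have -> : restr_map g _ p = 0 := E2.
      exact: linear0.
    exists (restr_out _ K k', 0); congr (_, _); first by rewrite k0 /= oppr0.
    rewrite -[RHS]/(restr_map f _ (restr_out _ K k') + 0) addr0; apply:
      restr_inj; rewrite restr_mapE pE restr_outK // => ia.
    by apply: f_inj; rewrite -pE [p]restr_in0 ?linear0.
  move=> y _; have [p pE] := g_sur (restr_in y).
  exists (0, restr_out _ P p); split.
    congr (_, _); first exact: oppr0.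
    by rewrite -[LHS]/(restr_map f _ 0 + 0) linear0 addr0.
  exists 0; rewrite linear0 addr0; apply: restr_inj.
  rewrite -[RHS]/(restr_in (restr_map _ _ _)) restr_mapE restr_outE pE.
  case: ifP => // /negbT ia; by rewrite linear0 -pE [y]restr_in0 // linear0.
apply: good_resolution_cone; first exact: IH.
exact: good_resolution_projective.
Qed.

End Resolutions.

Section BrutalTruncation.
Variable S : pzRingType.

(** A Kronecker delta with values in linear maps, so that a map supported in one degree has a
    formula uniform in [i]. *)
Definition at_degree (X : int -> lmodType S) a i : {linear X a -> X i} :=
  match a =P i with
  | ReflectT e => ecast j {linear X a -> X j} e (id_linear (X a))
  | ReflectF _ => zero_linear (X a) (X i)
  end.

Lemma at_degree_eq X a x : at_degree X a a x = x.
Proof. by rewrite /at_degree; case: eqP => // e;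
  rewrite (eq_irrelevance e erefl). Qed.

Lemma at_degree_neq X a i x : a != i -> at_degree X a i x = 0.
Proof. by rewrite /at_degree; case: eqP. Qed.

Variables (X : complex S) (a : int).

Lemma at_degree_d b i (x : X b) :
  cd X i (at_degree X b i x) = at_degree X (b + 1) (i + 1) (cd X b x).
Proof.
have [<-|bi] := eqVneq b i; first by rewrite !at_degree_eq.
rewrite !at_degree_neq ?linear0 //.
by apply: contra bi => /eqP bi; apply/eqP; lia.
Qed.

Definition trunc_d i : {linear restr (a < i) (X i) ->
  restr (a < i + 1) (X (i + 1))} :=
  comp_linear (restr_out _ _) (comp_linear (cd X i) restr_in).

Lemma trunc_dE i x : restr_in (trunc_d i x) = cd X i (restr_in x).
Proof.
apply: restr_outK => ai; rewrite [x]restr_in0 ?linear0 //.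
by apply: contra ai => ai; lia.
Qed.

Fact trunc_dd i x : trunc_d (i + 1) (trunc_d i x) = 0.
Proof. by apply: restr_inj; rewrite !trunc_dE cdd linear0. Qed.
Fact trunc_bound : exists n : int, forall i, (n < i) || (i < - n) ->
  forall x : restr (a < i) (X i), x = 0.
Proof.
have [n Xn] := cbound X; exists n => i ni x.
by apply: restr_inj; rewrite (Xn i ni (restr_in x)) linear0.
Qed.
Definition trunc : complex S :=
  Complex (fun i => restr_fin_gen (a < i) (cfg X i)) trunc_dd trunc_bound.

(* [X] is the cone of this map when it vanishes below degree [a]. *)
Definition trunc_fun i : {linear single (a + 1) (cfg X a) i -> trunc i} :=
  comp_linear (restr_out _ _) (comp_linear (at_degree X (a + 1) i)
    (comp_linear (cd X a) restr_in)).

Lemma trunc_funE i x :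
  restr_in (trunc_fun i x) = at_degree X (a + 1) i (cd X a (restr_in x)).
Proof.
apply: restr_outK => ai; rewrite [x]restr_in0 ?linear0 //=.
by apply: contra ai => /eqP ->; lia.
Qed.

Fact trunc_chain i (x : single (a + 1) (cfg X a) i) :
  trunc_fun (i + 1) (cd (single (a + 1) (cfg X a)) i x) = cd trunc i (trunc_fun
    i x).
Proof.
transitivity (0 : trunc (i + 1)); first exact: linear0.
apply: restr_inj; rewrite -[cd _ _ _]/(trunc_d i (trunc_fun i x)).
by rewrite trunc_dE trunc_funE at_degree_d cdd !linear0.
Qed.
Definition trunc_map : chain_map (single (a + 1) (cfg X a)) trunc :=
  ChainMap trunc_chain.

(** The term [X a] was placed in degree [a + 1] because the cone shifts its source back to degree
    [a]. *)
Definition untrunc_fun i (p : cone trunc_map i) : X i :=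
  at_degree X a i (restr_in p.1) + restr_in p.2.
Fact untrunc_linear i : linear (@untrunc_fun i).
Proof.
move=> s p q; rewrite /untrunc_fun -[(s *: p + q).1]/(s *: p.1 + q.1).
by rewrite -[(s *: p + q).2]/(s *: p.2 + q.2) !linearP scalerDr; zmod.
Qed.
Fact untrunc_chain i (p : cone trunc_map i) :
  mk_linear (@untrunc_linear (i + 1)) (cd (cone trunc_map) i p) =
  cd X i (mk_linear (@untrunc_linear i) p).
Proof.
case: p => x y; rewrite -[LHS]/(at_degree X a (i + 1) (restr_in (- 0)) +
  restr_in (trunc_fun (i + 1) x + trunc_d i y)).
rewrite -[RHS]/(cd X i (at_degree X a i (restr_in x) + restr_in y)).
rewrite !linearD trunc_dE trunc_funE oppr0 !linear0 add0r.
by rewrite at_degree_d.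
Qed.
Definition untrunc : chain_map (cone trunc_map) X := ChainMap untrunc_chain.

Lemma untrunc_quasi_iso : (forall i, i < a -> forall x : X i, x = 0) ->
  @quasi_iso S (cone trunc_map) X untrunc.
Proof.
move=> X0; apply: quasi_iso_bij => i; last first.
  move=> y; have [ai|ai] := eqVneq i a.
    move: y; rewrite {}ai => y.
    exists (restr_out _ _ y, 0); rewrite /= /untrunc_fun linear0 addr0.
    by rewrite restr_outE eqxx at_degree_eq.
  exists (0, restr_out _ _ y); rewrite /= /untrunc_fun !linear0 add0r.
  by rewrite restr_outK // => ia; apply: X0; lia.
apply: raddf_inj => -[x y].
rewrite -[X in X = 0]/(at_degree X a i (restr_in x) + restr_in y).
have [ai|ai] := eqVneq i a.
  have -> : y = 0 by apply: restr_in0; rewrite ai ltxx.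
  rewrite linear0 addr0; move: x y; rewrite {}ai => x y.
  rewrite at_degree_eq => x0; congr (_, _); apply: restr_inj; exact: x0.
have -> : x = 0 by apply: restr_in0; apply: contra ai => /eqP ai; apply/eqP;
  lia.
rewrite !linear0 add0r => y0; congr (_, _); apply: restr_inj; exact: y0.
Qed.

End BrutalTruncation.

Section ResolutionExistence.
Variables (S S' : pzRingType) (c : corner S S').
Variable d : nat.
Hypothesis S_gldim : forall M : lmodType S, fin_gen M -> fg_projdim_le d M.

(** Induction on the length of an interval of degrees outside which the complex vanishes. Its lowest
    term is resolved through the bound [d], and the complex is the cone of a map from that term to
    the rest. *)
Theorem good_resolution (X : complex S) : has_good_resolution c X.
Proof.
have [n Xn] := cbound X.
suff H (k : nat) (Y : complex S) a :
    (forall i, (i < a) || (a + k%:Z <= i) -> forall x : Y i, x = 0) ->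
    has_good_resolution c Y.
  (* The interval from [-|n|] to [|n| + 1] contains every degree between [- n] and [n]. *)
  apply: (H (`|n| * 2 + 2)%N X (- `|n|%N%:Z)) => i ai.
  by apply: Xn; lia.
elim: k Y a => [|k IH] Y a Y0.
  have Y_0 i (x : Y i) : x = 0 by apply: Y0; lia.
  have fg0 : fin_gen ('rV[S]_0 : lmodType S) := free_fin_gen S 0.
  have f_chain i (x : single 0 fg0 i) :
      zero_linear _ (Y (i + 1)) (cd (single 0 fg0) i x) =
      cd Y i (zero_linear (single 0 fg0 i) (Y i) x) by rewrite /= linear0.
  apply: (good_resolution_quasi_iso (f := ChainMap f_chain) _
    (good_resolution_projective c 0 fg0 (@free_projective S 0))).
  apply: quasi_iso_bij => i; last by move=> y; exists 0;
    rewrite [y](Y_0 i) linear0.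
  by move=> x y _; apply: restr_inj; rewrite [LHS]thinmx0 [RHS]thinmx0.
apply: (good_resolution_quasi_iso (untrunc_quasi_iso (X := Y) (a := a) _)).
  by move=> i ai; apply: Y0; rewrite ai.
apply: good_resolution_cone.
  by apply: good_resolution_single; apply: S_gldim; apply: cfg.
apply: (IH _ (a + 1)) => i ai x; have [lt_ai|le_ia] := ltP a i.
  by apply: restr_inj; rewrite [LHS](Y0 i) ?linear0 //; lia.
by apply: restr_in0; rewrite -leNgt.
Qed.

End ResolutionExistence.

(** * The left adjoint *)

Section LeftAdjoint.
Variables (S S' : pzRingType) (c : corner S S').
Hypothesis resolvable : forall X : complex S, has_good_resolution c X.

Let Psi : functor (Kb S') (Kb S) := corner_functor c.
Let sh (X : Kb S') : @hom (Kb S) (Psi (shift (Kb S') X)) (shift (Kb S) (Psi X))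
  :=
  corner_shift c X.

(** The choices for different [X] are unrelated; [lift_unique] is what makes them assemble into a
    functor. *)
Definition resol (X : Kb S) : Kb S' := projT1 (cid (resolvable X)).

Lemma resol_good X : good_complex c (resol X).
Proof. by case: (projT2 (cid (resolvable X))). Qed.

Let resol_ex X := (projT2 (cid (resolvable X))).2.
Definition aug (X : Kb S) : @hom (Kb S) (Psi (resol X)) X :=
  projT1 (cid (resol_ex X)).

Lemma aug_quasi_iso X : quasi_iso (aug X).
Proof. exact: projT2 (cid (resol_ex X)). Qed.

(** With [lift_unique], the lifting property rephrased in the operations of [Kb], so that setoid
    rewriting applies from here on. *)
Lemma lift_exists (Q Y : Kb S') (Z : Kb S) (s : @hom (Kb S) (Psi Y) Z)
    (f : @hom (Kb S) (Psi Q) Z) : good_complex c Q -> quasi_iso s ->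
  exists g : @hom (Kb S') Q Y, s ** fmap Psi g ~~ f.
Proof. exact: good_complex_lift. Qed.

Lemma lift_unique (Q Y : Kb S') (Z : Kb S) (s : @hom (Kb S) (Psi Y) Z)
    (g g' : @hom (Kb S') Q Y) : good_complex c Q -> quasi_iso s ->
  s ** fmap Psi g ~~ s ** fmap Psi g' -> g ~~ g'.
Proof. exact: good_complex_inj. Qed.

Lemma resolution_iso (Q Q' : Kb S') (X : Kb S) (s : @hom (Kb S) (Psi Q) X)
    (s' : @hom (Kb S) (Psi Q') X) (g : @hom (Kb S') Q Q') :
  good_complex c Q -> good_complex c Q' -> quasi_iso s -> quasi_iso s' ->
  s' ** fmap Psi g ~~ s -> is_iso g.
Proof.
move=> gQ gQ' qs qs' sg; have [h hP] := lift_exists s' gQ' qs; exists h; split.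
  by apply: (lift_unique gQ qs); rewrite fmap_comp comp_assoc hP sg fmap_id
    comp_idr.
by apply: (lift_unique gQ' qs'); rewrite fmap_comp comp_assoc sg hP fmap_id
  comp_idr.
Qed.

Let resol_hom_ex (X Y : Kb S) (f : @hom (Kb S) X Y) :=
  cid (lift_exists (f ** aug X) (@resol_good X) (@aug_quasi_iso Y)).
Definition resol_hom (X Y : Kb S) (f : @hom (Kb S) X Y) :
  @hom (Kb S') (resol X) (resol Y) := projT1 (resol_hom_ex f).

Lemma resol_homP (X Y : Kb S) (f : @hom (Kb S) X Y) :
  aug Y ** fmap Psi (resol_hom f) ~~ f ** aug X.
Proof. exact: projT2 (resol_hom_ex f). Qed.

Fact resol_heq (X Y : Kb S) (f g : @hom (Kb S) X Y) :
  f ~~ g -> resol_hom f ~~ resol_hom g.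
Proof.
move=> fg; apply: (lift_unique (@resol_good X) (@aug_quasi_iso Y)).
by rewrite !resol_homP fg.
Qed.
Fact resol_id (X : Kb S) : resol_hom (idm X) ~~ idm (resol X).
Proof.
apply: (lift_unique (@resol_good X) (@aug_quasi_iso X)).
by rewrite resol_homP fmap_id comp_idl comp_idr.
Qed.
Fact resol_comp (X Y Z : Kb S) (g : @hom (Kb S) Y Z) (f : @hom (Kb S) X Y) :
  resol_hom (g ** f) ~~ resol_hom g ** resol_hom f.
Proof.
apply: (lift_unique (@resol_good X) (@aug_quasi_iso Z)).
by rewrite resol_homP fmap_comp comp_assoc resol_homP -!comp_assoc
  resol_homP.
Qed.
Definition resol_functor : functor (Kb S) (Kb S') :=
  Functor resol_heq resol_id resol_comp.

Lemma quasi_iso_compose (X Y Z : Kb S) (g : @hom (Kb S) Y Z) (f :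
  @hom (Kb S) X Y) :
  quasi_iso g -> quasi_iso f -> quasi_iso (g ** f).
Proof. exact: quasi_iso_comp. Qed.

(** Both [f ** aug X] and [aug Y] are good resolutions of [Y], and [resol_hom f] compares them. *)
Lemma resol_inverts (X Y : Kb S) (f : @hom (Kb S) X Y) :
  quasi_iso f -> is_iso (resol_hom f).
Proof.
move=> qf; apply: resolution_iso (resol_homP f).
- exact: resol_good.
- exact: resol_good.
- exact: quasi_iso_compose qf (@aug_quasi_iso X).
- exact: aug_quasi_iso.
Qed.

Let shift_aug (X : Kb S) :
    @hom (Kb S) (Psi (shift (Kb S') (resol X))) (shift (Kb S) X) :=
  fmap (shift (Kb S)) (aug X) ** sh (resol X).

Lemma shift_aug_quasi_iso X : quasi_iso (shift_aug X).
Proof.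
apply: quasi_iso_compose; first exact/quasi_iso_shift/aug_quasi_iso.
by apply: quasi_iso_bij => i // y; exists y.
Qed.

Lemma good_shift (Q : Kb S') : good_complex c Q ->
  good_complex c (shift (Kb S') Q).
Proof. by move=> gQ i; apply: gQ. Qed.

Let resol_shift_ex (X : Kb S) :=
  cid (lift_exists (aug (shift (Kb S) X)) (@resol_good _) (@shift_aug_quasi_iso
    X)).
Definition resol_shift (X : Kb S) :
    @hom (Kb S') (resol (shift (Kb S) X)) (shift (Kb S') (resol X)) :=
  projT1 (resol_shift_ex X).

Lemma resol_shiftP X :
  shift_aug X ** fmap Psi (resol_shift X) ~~ aug (shift (Kb S) X).
Proof. exact: projT2 (resol_shift_ex X). Qed.

Lemma resol_shift_iso X : is_iso (resol_shift X).
Proof.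
apply: resolution_iso (resol_shiftP X).
- exact: resol_good.
- exact/good_shift/resol_good.
- exact: aug_quasi_iso.
- exact: shift_aug_quasi_iso.
Qed.

Lemma sh_nat (X Y : Kb S') (f : @hom (Kb S') X Y) :
  sh Y ** fmap Psi (fmap (shift (Kb S')) f) ~~
  fmap (shift (Kb S)) (fmap Psi f) ** sh X.
Proof. exact: corner_shift_nat. Qed.

Lemma resol_shift_nat (X Y : Kb S) (f : @hom (Kb S) X Y) :
  resol_shift Y ** fmap resol_functor (fmap (shift (Kb S)) f) ~~
  fmap (shift (Kb S')) (fmap resol_functor f) ** resol_shift X.
Proof.
apply: (lift_unique (@resol_good _) (@shift_aug_quasi_iso Y)).
rewrite !(fmap_comp Psi) !comp_assoc resol_shiftP.
rewrite [fmap resol_functor _]/(resol_hom _) resol_homP.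
rewrite /shift_aug -(comp_assoc _ (sh _)) sh_nat !comp_assoc -fmap_comp.
rewrite [fmap resol_functor _]/(resol_hom _) resol_homP fmap_comp.
by rewrite -!comp_assoc (comp_assoc _ (sh _)) resol_shiftP.
Qed.

(** The cone of [resol_hom f] is itself a good resolution of [cone f], through [r], so its
    comparison [k] with the chosen one is invertible. The squares are checked after composing with
    quasi-isomorphisms, by [lift_unique]. *)
Lemma resol_cone_triangle (X Y : complex S) (f : chain_map X Y) :
  triangle_iso (@triangle_image (Kb S) (Kb S') (shift (Kb S)) (shift (Kb S'))
      resol_functor resol_shift (cone_triangle f))
    (cone_triangle (resol_hom (f : @hom (Kb S) X Y))).
Proof.
pose f' : @hom (Kb S) X Y := f; pose g := resol_hom f'.
have [r [qr r_inj r_proj]] := good_resolution_cone_map (@aug_quasi_iso X)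
  (@aug_quasi_iso Y) (resol_homP f').
pose R : @hom (Kb S) (Psi (cone g)) (cone f) := r.
have gcone : good_complex c (cone g) by apply: good_cone; apply: resol_good.
have [k kP] := lift_exists (aug (cone f)) (@resol_good (cone f)) (qr :
  quasi_iso R).
pose vf : @hom (Kb S) Y (cone f) := cone_inj f.
pose wf : @hom (Kb S) (cone f) (shift (Kb S) X) := cone_proj f.
pose vg : @hom (Kb S') (resol Y) (cone g) := cone_inj g.
pose wg : @hom (Kb S') (cone g) (shift (Kb S') (resol X)) := cone_proj g.
have R_inj : R ** fmap Psi vg ~~ vf ** aug Y by exact: r_inj.
have R_proj : wf ** R ~~ shift_aug X ** fmap Psi wg.
  by rewrite /shift_aug -comp_assoc; exact: r_proj.
have Ev : k ** resol_hom vf ~~ vg.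
  apply: (lift_unique (@resol_good _) (qr : quasi_iso R)).
  by rewrite fmap_comp comp_assoc kP R_inj resol_homP.
have Ew : resol_shift X ** resol_hom wf ~~ wg ** k.
  apply: (lift_unique (@resol_good _) (@shift_aug_quasi_iso X)).
  rewrite !fmap_comp !comp_assoc resol_shiftP -R_proj -comp_assoc kP.
  exact: resol_homP.
exists (idm _), (idm _), k; split; split.
- exact: iso_id.
- exact: iso_id.
- apply: resolution_iso kP => //; [exact: resol_good | exact: aug_quasi_iso].
- by rewrite comp_idl comp_idr; exact: heq_refl.
- by rewrite comp_idr; exact: Ev.
- by rewrite (fmap_id (shift (Kb S'))) comp_idl; exact: Ew.
Qed.

Lemma resol_dist (t : triangle (shift (Kb S))) : dist t ->
  dist (@triangle_image (Kb S) (Kb S') (shift (Kb S)) (shift (Kb S'))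
      resol_functor resol_shift t).
Proof.
case=> X [Y [f I0]]; have I := @triangle_image_iso (Kb S) (Kb S')
  (shift (Kb S)) (shift (Kb S')) resol_functor resol_shift resol_shift_nat
  _ _ I0.
exists (resol X), (resol Y), (resol_hom (f : @hom (Kb S) X Y)).
exact: triangle_iso_trans I (resol_cone_triangle f).
Qed.

Definition resol_tri_functor : triangle_functor (Kb S) (Kb S') :=
  @TriFunctor (Kb S) (Kb S') resol_functor resol_shift resol_shift_iso
    resol_shift_nat resol_dist.

Let counit_ex (Y : Kb S') :=
  cid (good_complex_full (c := c) (aug (Psi Y)) (@resol_good (Psi Y))).
(** [aug (Psi Y)] is a map between corners whose source comes from a good complex, so it lifts to
    [S']. *)
Definition counit (Y : Kb S') : @hom (Kb S') (resol (Psi Y)) Y :=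
  projT1 (counit_ex Y).

Lemma counitP Y : fmap Psi (counit Y) ~~ aug (Psi Y).
Proof. exact: projT2 (counit_ex Y). Qed.

Lemma quasi_iso_id (X : Kb S) : quasi_iso (idm X).
Proof. by apply: quasi_iso_bij => i // y; exists y. Qed.

Lemma counit_nat (Y Z : Kb S') (g : @hom (Kb S') Y Z) :
  counit Z ** resol_hom (fmap Psi g) ~~ g ** counit Y.
Proof.
apply: (lift_unique (@resol_good _) (quasi_iso_id (Psi Z))).
by rewrite !comp_idl !fmap_comp !counitP resol_homP.
Qed.

(** The triangle identity asked by [fully_faithful_criterion]; [aug] becomes the inverse of the unit
    once quasi-isomorphisms are inverted. *)
Lemma counit_resol (X : Kb S) : counit (resol X) ~~ resol_hom (aug X).
Proof.
apply: (lift_unique (@resol_good _) (@aug_quasi_iso X)).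
by rewrite resol_homP counitP.
Qed.

Lemma quasi_iso_Linc (T : pzRingType) (X Y : Kb T) (s : @hom (Kb T) X Y) :
  quasi_iso s -> @is_iso (Db T) X Y (Linc _ s).
Proof. by move=> qs; exists (Linv qs); split; [apply: Leq_inv_l | apply:
  Leq_inv_r]. Qed.

Fact resol_Db_inverts (X Y : Kb S) (s : @hom (Kb S) X Y) : quasi_iso s ->
  @is_iso (Db S') _ _ (Linc (@quasi_iso S') (fmap resol_tri_functor s)).
Proof. by move=> qs; apply/Linc_iso/resol_inverts. Qed.
Definition resol_Db : triangle_functor (Db S) (Db S') :=
  tri_loc_map (@quasi_iso_shift S) (@quasi_iso_shift S') resol_Db_inverts.

Fact corner_Db_inverts (X Y : Kb S') (s : @hom (Kb S') X Y) : quasi_iso s ->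
  @is_iso (Db S) _ _ (Linc (@quasi_iso S) (fmap (corner_tri_functor c) s)).
Proof. by move=> qs; apply/quasi_iso_Linc/corner_quasi_iso. Qed.
Definition corner_Db : triangle_functor (Db S') (Db S) :=
  tri_loc_map (@quasi_iso_shift S') (@quasi_iso_shift S) corner_Db_inverts.

Section Quotients.
Variables (G : Db S) (G' : Db S') (r : @hom (Kb S) (Psi G') G).
Hypotheses (goodG' : good_complex c G') (qr : quasi_iso r).

(** Through [r], the object [G'] is a good resolution of [G], hence isomorphic to the chosen one. *)
Lemma resol_gen : thick G' (resol_Db G).
Proof.
have [g gP] := lift_exists r goodG' (@aug_quasi_iso G).
have /Linc_iso gI : is_iso g.
  exact: resolution_iso goodG' (@resol_good G) qr (@aug_quasi_iso G) gP.
by apply/(thick_iso (thick_is_thick G') (gI _)) => P _.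
Qed.

Lemma corner_gen : thick G (corner_Db G').
Proof. by apply/(thick_iso (thick_is_thick G) (quasi_iso_Linc qr)) => P _. Qed.

Theorem resol_verdier_fully_faithful : fully_faithful (verdier_map resol_gen).
Proof.
pose W := @cone_in (Db S) (thick G); pose W' := @cone_in (Db S') (thick G').
pose LL X Y (f : @hom (Kb S) X Y) : @hom (localization W) X Y :=
  Linc W (Linc (@quasi_iso S) f).
pose LL' X Y (f : @hom (Kb S') X Y) : @hom (localization W') X Y :=
  Linc W' (Linc (@quasi_iso S') f).
pose F := verdier_map resol_gen; pose H := verdier_map corner_gen.
apply: (@fully_faithful_criterion _ _ F H (fun X => LL _ _ (aug X))
  (fun Y => LL' _ _ (counit Y))).
- by move=> X; apply: Linc_iso; apply/quasi_iso_Linc/aug_quasi_iso.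
(* The quotient is a localization of a localization, so [loc_natural] is applied twice to reduce
   naturality to [Kb]. *)
- apply: (@loc_natural _ _ _ (comp_functor H F) (id_functor _)
    (fun X => LL _ _ (aug X))) => X Y f.
  apply: (@loc_natural _ _ _ (comp_functor (comp_functor H F) (loc_functor W))
    (loc_functor W) (fun X => LL _ _ (aug X))) => {f} {}X {}Y f.
  apply: Leq_trans (Leq_sym (Leq_inc_comp _ _ _)) _.
  apply: Leq_trans (Leq_inc_comp _ _ _); apply: Leq_inc.
  apply: Leq_trans (Leq_sym (Leq_inc_comp _ _ _)) _.
  apply: Leq_trans (Leq_inc_comp _ _ _); apply: Leq_inc.
  exact: resol_homP.
- apply: (@loc_natural _ _ _ (comp_functor F H) (id_functor _)
    (fun Y => LL' _ _ (counit Y))) => X Y f.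
  apply: (@loc_natural _ _ _ (comp_functor (comp_functor F H) (loc_functor W'))
    (loc_functor W') (fun Y => LL' _ _ (counit Y))) => {f} {}X {}Y f.
  apply: Leq_trans (Leq_sym (Leq_inc_comp _ _ _)) _.
  apply: Leq_trans (Leq_inc_comp _ _ _); apply: Leq_inc.
  apply: Leq_trans (Leq_sym (Leq_inc_comp _ _ _)) _.
  apply: Leq_trans (Leq_inc_comp _ _ _); apply: Leq_inc.
  exact: counit_nat.
- by move=> X; apply/Leq_inc/Leq_inc/counit_resol.
Qed.

End Quotients.
End LeftAdjoint.

(** * Noetherian endomorphism rings *)

Section NoetherianModules.
Variable R : pzRingType.

Definition noetherian_module (U : lmodType R) :=
  forall p : submodule U, fin_gen (submod_type p).

(** The [f i] embed [K] in U^n. By induction, the image of the first map is a submodule of [U], and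
    its kernel embeds in U^(n-1) through the others; generators of both are combined. *)
Lemma noetherian_joint_kernel (U : lmodType R) n (K : lmodType R)
    (f : 'I_n -> {linear K -> U}) :
  noetherian_module U -> (forall x, (forall i, f i x = 0) -> x = 0) ->
    fin_gen K.
Proof.
move=> noethU; elim: n K f => [|n IH] K f f0.
  exists 0%N, (fun _ => 0) => x; exists (fun _ => 0).
  by rewrite big_ord0; apply: f0 => -[].
pose g := f ord0; have [m [v v_gen]] := noethU (image_submod g).
have /choice[y yE] j : exists x, submod_val _ (v j) = g x.
  by have /asboolP := submod_valP (v j).
have [|l [z z_gen]] := IH (submod_type (ker_submod g))
  (fun i => comp_linear (f (lift ord0 i)) (submod_val (ker_submod g))).
  move=> x fx; apply: submod_val_inj; rewrite linear0; apply: f0 => i.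
  by have [j ->|->] := unliftP ord0 i; [apply: fx | apply/eqP/(submod_valP x)].
apply: (@fin_gen_finType _ _ ('I_m + 'I_l)%type (fun s => match s with
  | inl j => y j | inr j => submod_val _ (z j) end)) => x.
have gx : g x \in image_submod g by apply/asboolP; exists x.
have [a /(congr1 (submod_val _)) gxE] := v_gen (Sub (g x) gx).
have rK : x - \sum_j a j *: y j \in ker_submod g.
  rewrite inE linearB linear_sum -[g x]/(submod_val _ (Sub (g x) gx)) gxE.
  rewrite linear_sum -sumrB big1 // => j _.
  by rewrite [g _]linearZ linearZ yE; apply: subrr.
have [b /(congr1 (submod_val _)) rE] := z_gen (Sub (x - \sum_j a j *: y j) rK).
exists (fun s => match s with inl j => a j | inr j => b j end).
rewrite big_sumType /= -[LHS](subrK (\sum_j a j *: y j)) [LHS]addrC.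
by congr (_ + _); rewrite [LHS]rE linear_sum; apply: eq_bigr => j _;
  rewrite linearZ.
Qed.

(** The preimage [L] of [K] in a free cover of [M] is finitely generated, by its coordinate maps to
    [R], and maps onto [K]. *)
Lemma noetherian_left : noetherian_module R^o -> left_noetherian R.
Proof.
move=> noethR K M f f_inj /free_cover[n [g g_sur]].
have L_closed : submod_closed [pred v : 'rV[R]_n | `[< exists x, g v = f x >]].
  split=> [|a v w]; rewrite !inE; first by apply/asboolP; exists 0;
    rewrite !linear0.
  move=> /asboolP[x vx] /asboolP[y wy]; apply/asboolP; exists (a *: x + y).
  by rewrite !linearP vx wy.
pose L := submod_type (Submodule L_closed).
pose i := submod_val (Submodule L_closed).
have coord_lin j : linear (fun v : L => i v 0 j : R^o).
  by move=> a v w; rewrite linearP !mxE.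
have fgL : fin_gen L.
  apply: (noetherian_joint_kernel (f := fun j =>
    mk_linear (coord_lin j)) noethR).
  move=> v v0; apply: submod_val_inj; apply/rowP => j.
  by rewrite linear0 mxE; apply: v0.
have [|h hE] := injective_lift (g := f) (f := comp_linear g i) f_inj.
  by move=> v; have /asboolP := submod_valP v.
apply: (fin_gen_image (f := h) fgL) => x; have [v vE] := g_sur (f x).
have vL : v \in Submodule L_closed by apply/asboolP; exists x.
by exists (Sub v vL); apply: f_inj; rewrite hE.
Qed.

End NoetherianModules.

Lemma noetherian_ring_module (R : comPzRingType) :
  noetherian R -> noetherian_module R^o.
Proof.
move=> noethR p; have [n [v [v_in v_gen]]] := noethR p (submod_predP p).
exists n, (fun i => Sub (v i : R^o) (v_in i)) => x.
have [a xE] := v_gen _ (submod_valP x); exists a.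
apply: submod_val_inj; rewrite xE linear_sum.
by apply: eq_bigr => i _; rewrite linearZ.
Qed.

Section RestrictionOfScalars.
Variables (R S : pzRingType) (rho : {rmorphism R -> S}).

(** An alias, so that the [R]-module structure can live beside the [S]-module structure on the same
    carrier. *)
Definition restriction (M : lmodType S) : Type := M.
HB.instance Definition _ (M : lmodType S) := GRing.Zmodule.on (restriction M).

Definition restriction_scale (M : lmodType S) (r : R) (x : restriction M) :
  restriction M := rho r *: (x : M).
Fact restriction_scaleA (M : lmodType S) a b (x : restriction M) :
  restriction_scale a (restriction_scale b x) = restriction_scale (a * b) x.
Proof. by rewrite /restriction_scale scalerA rmorphM. Qed.
Fact restriction_scale1 (M : lmodType S) : left_id 1 (@restriction_scale M).
Proof. by move=> x; rewrite /restriction_scale rmorph1 scale1r. Qed.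
Fact restriction_scaleDr (M : lmodType S) :
  right_distributive (@restriction_scale M) +%R.
Proof. by move=> a x y; rewrite /restriction_scale scalerDr. Qed.
Fact restriction_scaleDl (M : lmodType S) (x : restriction M) :
  {morph (@restriction_scale M)^~ x : a b / a + b}.
Proof. by move=> a b; rewrite /restriction_scale rmorphD scalerDl. Qed.
HB.instance Definition _ (M : lmodType S) :=
  GRing.Zmodule_isLmodule.Build R (restriction M) (@restriction_scaleA M)
    (@restriction_scale1 M) (@restriction_scaleDr M) (@restriction_scaleDl M).

Hypothesis finite_rho : exists (n : nat) (w : 'I_n -> S),
  forall b, exists r : 'I_n -> R, b = \sum_i rho (r i) * w i.

(** A finitely generated [S]-module is finitely generated over [R], and generators of [K] over [R]
    generate it over [S]. *)
Lemma finite_left_noetherian : left_noetherian R -> left_noetherian S.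
Proof.
move=> noethR K M f f_inj [m [v v_gen]]; have [n [w w_gen]] := finite_rho.
have f_lin : linear (f : restriction K -> restriction M).
  by move=> a x y; exact: (linearP f (rho a)).

have fgM : fin_gen (restriction M : lmodType R).
  apply: (@fin_gen_finType _ _ ('I_m * 'I_n)%type
    (fun ij => w ij.2 *: v ij.1 : restriction M)) => x.
  have [b xE] := v_gen x; have /choice[r rE] i := w_gen (b i).
  exists (fun ij => r ij.1 ij.2).
  rewrite -(pair_bigA _ (fun i j => r i j *: (w j *: v i : restriction M))) /=.
  rewrite {1}xE; apply: eq_bigr => i _; rewrite rE scaler_suml.
  by apply: eq_bigr => j _; rewrite -scalerA.
have [l [z z_gen]] := noethR _ _ (mk_linear f_lin) f_inj fgM.
exists l, z => x; have [a xE] := z_gen x; exists (fun i => rho (a i)).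
by rewrite [LHS]xE.
Qed.

End RestrictionOfScalars.

Section EndomorphismRings.
Variable R : comPzRingType.
Hypothesis noethR : noetherian R.

Section Finiteness.
Variables (U : lmodType R) (fgU : fin_gen U).

(** Evaluation at [m] generators of [U] embeds its endomorphisms in U^m, where submodules are
    finitely generated. *)
Lemma endo_finite : exists (n : nat) (w : 'I_n -> endo U),
  forall b : endo U, exists r : 'I_n -> R, forall x, b x = \sum_i r i *: w i x.
Proof.
have noethM := noetherian_left (noetherian_ring_module noethR).
have noethU : noetherian_module U.
  by move=> p; apply: noethM fgU; apply: submod_val_inj.
have [m [u u_gen]] := fgU.
(* The value tuples of endomorphisms stand in for [endo U], which carries no [R]-module structure of
   its own here. *)
have T_closed : submod_closed
    [pred t : {ffun 'I_m -> U} | `[< exists b : endo U, forall i,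
      t i = b (u i) >]].
  split=> [|a s t]; rewrite !inE.
    by apply/asboolP; exists 0 => i; rewrite ffunE.
  move=> /asboolP[b sE] /asboolP[b' tE]; apply/asboolP.
  have lin : linear (fun x => a *: b x + b' x).
    by move=> r x y; rewrite (linearP b) (linearP b') !scalerDr !scalerA mulrC;
      zmod.
  by exists (mk_linear lin) => i; rewrite !ffunE sE tE.
pose T := submod_type (Submodule T_closed).
pose val_T := submod_val (Submodule T_closed).
have ev_lin i : linear (fun t : T => val_T t i).
  by move=> a s t; rewrite linearP !ffunE.
have [|n [t t_gen]] := noetherian_joint_kernel (f := fun i =>
  mk_linear (ev_lin i))
  noethU.
  move=> t t0; apply: submod_val_inj; apply/ffunP => i.
  by rewrite linear0 [RHS]ffunE; apply: t0.
have /choice[w wE] j : exists b : endo U, forall i, val_T (t j) i = b (u i).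
  by have /asboolP := submod_valP (t j).
exists n, w => b.
have bT : [ffun i => b (u i)] \in Submodule T_closed.
  by apply/asboolP; exists b => i; rewrite ffunE.
have [r /(congr1 val_T) rE] := t_gen (Sub [ffun i => b (u i)] bT);
  exists r => x.
have bu i : b (u i) = \sum_j r j *: w j (u i).
  have /ffunP/(_ i) := rE; rewrite linear_sum sum_ffunE ffunE => ->.
  by apply: eq_bigr => j _; rewrite linearZ ffunE wE.
have [a ->] := u_gen x; rewrite linear_sum.
under [RHS]eq_bigr => j _ do rewrite linear_sum scaler_sumr.
rewrite exchange_big; apply: eq_bigr => i _ /=.
rewrite linearZ /= bu scaler_sumr; apply: eq_bigr => j _.
by rewrite (linearZ_LR (w j : {linear U -> U})) !scalerA mulrC.
Qed.

Fact scalar_endo_linear (r : R) : linear (fun x : U => r *: x).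
Proof. by move=> a x y; rewrite scalerDr !scalerA mulrC. Qed.
Definition scalar_endo (r : R) : (endo U)^c := mk_linear (scalar_endo_linear r).

Fact scalar_endo_zmod : zmod_morphism scalar_endo.
Proof. by move=> a b; apply: linearfun_ext => x; exact: scalerBl. Qed.
Fact scalar_endo_monoid : monoid_morphism scalar_endo.
Proof.
split=> [|a b]; apply: linearfun_ext => x; first exact: scale1r.
by rewrite /= scalerA mulrC.
Qed.
HB.instance Definition _ :=
  GRing.isZmodMorphism.Build R (endo U)^c scalar_endo scalar_endo_zmod.
HB.instance Definition _ :=
  GRing.isMonoidMorphism.Build R (endo U)^c scalar_endo scalar_endo_monoid.

Lemma endo_sumE (I : finType) (F : I -> endo U) x :
  (\sum_i F i) x = \sum_i F i x.
Proof. by elim/big_rec2: _ => // i y f _ <-. Qed.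

Lemma endo_left_noetherian : left_noetherian (endo U)^c.
Proof.
apply: (finite_left_noetherian (rho := scalar_endo)); last first.
  exact: noetherian_left (noetherian_ring_module noethR).
have [n [w w_gen]] := endo_finite; exists n, w => b.
have [r bE] := w_gen b; exists r; apply: linearfun_ext => x.
rewrite [LHS]bE (endo_sumE (fun i => scalar_endo (r i) * w i)).
by apply: eq_bigr => i _; rewrite -(linearZ_LR (w i : {linear U -> U})).
Qed.

End Finiteness.

Section Retract.
Variables (U V : lmodType R) (i : {linear U -> V}) (p : {linear V -> U}).
Hypotheses (pi : forall x, p (i x) = x) (fgV : fin_gen V).

(** [i p] is an idempotent of End(V), and this identifies End(U) with its corner; in particular 1
    goes to [i p]. *)
Definition retract_endo (a : (endo U)^c) : (endo V)^c :=
  comp_linear i (comp_linear (a : endo U) p).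
Fact retract_endo_zmod : zmod_morphism retract_endo.
Proof. by move=> a b; apply: linearfun_ext => x; rewrite /= linearB. Qed.
HB.instance Definition _ :=
  GRing.isZmodMorphism.Build (endo U)^c (endo V)^c retract_endo
    retract_endo_zmod.

Fact retract_endoM : {morph retract_endo : a b / a * b}.
Proof. by move=> a b; apply: linearfun_ext => x; rewrite /= pi. Qed.
Fact retract_endo_inj : injective retract_endo.
Proof.
move=> a b ab; apply: linearfun_ext => x.
by have /(congr1 (fun f : endo V => p (f (i x)))) := ab; rewrite /= !pi.
Qed.
Fact retract_endo_onto b : exists a, retract_endo 1 * b * retract_endo 1 =
  retract_endo a.
Proof.
by exists (comp_linear p (comp_linear (b : endo V) i)); apply: linearfun_ext.
Qed.
Fact retract_endo_fg : exists (n : nat) (w : 'I_n -> (endo V)^c),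
  forall b, exists a : 'I_n -> (endo U)^c,
    retract_endo 1 * b = \sum_i retract_endo (a i) * w i.
Proof.
have [n [w w_gen]] := endo_finite fgV; exists n, w => b.
have [r bE] := w_gen b; exists (fun i => scalar_endo U (r i)).
apply: linearfun_ext => x.
rewrite [LHS]bE (endo_sumE (fun j => retract_endo (scalar_endo U (r j)) * w j)).
apply: eq_bigr => j _.
rewrite -(linearZ_LR (w j : {linear V -> V})); congr (w j _).
exact: (esym (linearZ_LR i _ _)).
Qed.

Definition retract_corner : corner (endo U)^c (endo V)^c :=
  @Corner _ _ retract_endo retract_endoM retract_endo_inj retract_endo_onto
    retract_endo_fg.

End Retract.
End EndomorphismRings.

(** * The generators under the corner, and the conclusion *)

Section CornerGenerators.
Variables (B B' : pzRingType) (c : corner B^c B'^c) (e : B).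
Hypothesis ee : e * e = e.
Let e' : B' := c e.

Lemma cor_mulr (x y : B) : c (x * y : B) = ((c x : B') * (c y : B'))%R :> B'.
Proof. exact: (corM c (y : B^c) (x : B^c)). Qed.

Lemma right_idealP (x : right_ideal e) : e * (val x : B) = val x.
Proof. by have /asboolP[b ->] := valP x; rewrite mulrA ee. Qed.

Lemma right_idealP' (x : right_ideal e') : e' * (val x : B') = val x.
Proof. by have /asboolP[b ->] := valP x; rewrite mulrA -cor_mulr ee. Qed.

Lemma right_ideal_self : (e' : (B'^c)^o) \in right_ideal_pred e'.
Proof. by apply/asboolP; exists 1; rewrite mulr1. Qed.

(** A one-element dual basis: the generator [e'], fixed by [c 1] because it lies in the corner, and
    the inclusion into [B']. *)
Lemma right_ideal_good : good c (right_ideal e').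
Proof.
pose q : right_ideal e' := Sub (e' : (B'^c)^o) right_ideal_self.
have qC : q \in @corner_pred _ _ c (right_ideal e').
  rewrite inE; apply/eqP/val_inj; exact: (cor1l c e).
have b_lin : linear (fun x : right_ideal e' => val x :
  (B'^c)^o) by move=> a x y.
exists 1%N, (fun _ => Sub q qC), (fun _ => mk_linear b_lin) => x.
by rewrite big_ord1; apply: val_inj; exact: (esym (right_idealP' x)).
Qed.

(** Since [e' = e' * c 1], one has e' B' c(1) = e' (c(1) B' c(1)) = e' c(B) = c(e B). The inverse
    [g] of the required map is simply [c]. *)
Lemma right_ideal_corner :
  exists f : {linear corner_mod c (right_ideal e') -> right_ideal e},
    injective f /\ forall y, exists x, f x = y.
Proof.
have g1 (x : right_ideal e) : (c (val x) : (B'^c)^o) \in right_ideal_pred e'.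
  by apply/asboolP; exists (c (val x)); rewrite -cor_mulr right_idealP.
have g2 x : Sub (c (val x) : (B'^c)^o) (g1 x) \in @corner_pred _ _ c
  (right_ideal e').
  by rewrite inE; apply/eqP/val_inj; exact: (cor1l c (val x)).
pose g x : corner_mod c (right_ideal e') := Sub (Sub (c (val x)) (g1 x) :
  right_ideal e') (g2 x).
have g_lin : linear g.
  move=> a x y; do 2!apply: val_inj; rewrite /= raddfD; congr (_ + _).
  exact: corM.
have g_inj : injective (mk_linear g_lin).
  by move=> x y /(congr1 (fun z => val (val z))) /= /cor_inj xy; apply: val_inj.
have g_sur y : exists x, mk_linear g_lin x = y.
  pose z : B' := val (val y).
  have ze : z * c 1 = z := congr1 val (corner_modP y).
  have ez : e' * z = z := right_idealP' (val y).
  have [a aE] := cor_onto c (z : B'^c).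
  have aP : ((e * a : B) : (B^c)^o) \in right_ideal_pred e by apply/asboolP;
    exists a.
  exists (Sub (e * a : B) aP); do 2!apply: val_inj.
  rewrite -[RHS]ez -ze; rewrite [LHS]cor_mulr -aE.
  rewrite -[c 1 * z * c 1 in LHS]/((c 1 : B') * ((z : B') * (c 1 : B'))).
  by rewrite mulrA -cor_mulr mulr1.
have [f [fK Kf]] := linear_inverse g_inj g_sur.
by exists f; split; [apply: can_inj Kf | move=> y; exists (mk_linear g_lin y)].
Qed.

End CornerGenerators.

Section CornerStalks.
Variables (S S' : pzRingType) (c : corner S S').
Variables (M : lmodType S) (M' : lmodType S') (fgM : fin_gen M) (fgM' :
  fin_gen M').

Lemma good_stalk : good c M' -> good_complex c (stalk fgM').
Proof.
move=> gM' i; rewrite /= /stalk_mod; case: ifP => _ //.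
exists 0%N, (fun _ => 0), (fun _ => zero_linear _ _) => x.
by rewrite big_ord0 [x]thinmx0.
Qed.

Variable f : {linear corner_mod c M' -> M}.
Hypotheses (f_inj : injective f) (f_sur : forall y, exists x, f x = y).

(** Matching on a free boolean makes the types of both stalks reduce together; [b] is then
    instantiated with [i == 0]. *)
Definition corner_stalk_fun (b : bool) :
    {linear corner_mod c (if b then M' else 'rV[S']_0) ->
            (if b then M else 'rV[S]_0 : lmodType S)} :=
  match b with true => f | false => zero_linear _ _ end.

Fact corner_stalk_chain i (x : corner_complex c (stalk fgM') i) :
  corner_stalk_fun (i + 1 == 0) (cd (corner_complex c (stalk fgM')) i x) =
  cd (stalk fgM) i (corner_stalk_fun (i == 0) x).
Proof.
have -> : cd (corner_complex c (stalk fgM')) i x = 0 by exact: val_inj.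
exact: linear0.
Qed.
Definition corner_stalk : chain_map (corner_complex c (stalk fgM')) (stalk fgM)
  :=
  @ChainMap _ (corner_complex c (stalk fgM')) (stalk fgM)
    (fun i => corner_stalk_fun (i == 0)) corner_stalk_chain.

Lemma corner_stalk_quasi_iso :
  @quasi_iso S (corner_complex c (stalk fgM')) (stalk fgM) corner_stalk.
Proof.
have inj b : injective (corner_stalk_fun b).
  case: b => //= x y _; apply: val_inj.
  by rewrite [LHS]thinmx0 [RHS]thinmx0.
have sur b y : exists x, corner_stalk_fun b x = y.
  by case: b y => //= y; exists 0; rewrite [RHS]thinmx0.
by apply: quasi_iso_bij => i; [apply: inj | apply: sur].
Qed.

End CornerStalks.

Lemma fin_gen_pair (S : pzRingType) (M N : lmodType S) :
  fin_gen M -> fin_gen N -> fin_gen (M * N)%type.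
Proof.
move=> [m [v v_gen]] [n [w w_gen]].
apply: (@fin_gen_finType _ _ ('I_m + 'I_n)%type (fun s => match s with
  | inl i => (v i, 0) | inr j => (0, w j) end)) => -[x y].
have [a ->] := v_gen x; have [b ->] := w_gen y.
exists (fun s => match s with inl i => a i | inr j => b j end).
rewrite big_sumType [RHS]surjective_pairing /= !raddf_sum /=; congr (_, _).
  by rewrite [X in _ = _ + X]big1 ?addr0 // => j _; apply: scaler0.
by rewrite [X in _ = X + _]big1 ?add0r // => j _; apply: scaler0.
Qed.

Theorem proposition5p43 (k : closedFieldType) (R : comAlgType k)
    (m : {pred R})
    (R_gorenstein : gorenstein_local m)
    (R_complete : adically_complete m)
    (R_residue : residue_field_is m)
    (F' G' : lmodType R)
    (F'_fg : fin_gen F') (G'_fg : fin_gen G')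
    (F'_summand : direct_summand F' G')
    (A_gldim : finite_right_gldim (End_R_plus F')) :
  exists Phi : triangle_functor (rel_sing_cat F') (rel_sing_cat G'),
    fully_faithful Phi.
Proof.
have [_ noethR _] := R_gorenstein; have [d pdA] := A_gldim.
have [F'' [phi [psi phiK psiK]]] := F'_summand.
have fgR : fin_gen (R^o : lmodType R).
  by exists 1%N, (fun _ => 1) => x; exists (fun _ => x);
    rewrite big_ord1 [RHS]mulr1.
have psi_lin : linear psi.
  by move=> a x y; apply: (can_inj phiK); rewrite linearP !psiK.
(* Together with [p_fun], this exhibits R + F' as a retract of R + G' by maps that are the identity
   on R. *)
pose i_fun (x : (R^o * F')%type) : (R^o * G')%type := (x.1, phi (x.2, 0)).
have i_lin : linear i_fun.
  move=> a x y; congr (_, _); apply: etrans (linearP phi a (x.2, 0) (y.2, 0)).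
  by apply: (congr1 phi); congr (_, _); rewrite /= scaler0 addr0.
pose p_fun (x : (R^o * G')%type) : (R^o * F')%type := (x.1, (psi x.2).1).
have p_lin : linear p_fun.
  by move=> a x y; congr (_, _) => /=; rewrite psi_lin.
have pi x : mk_linear p_lin (mk_linear i_lin x) = x.
  by case: x => x y; rewrite /= /p_fun /i_fun /= phiK.
pose c := retract_corner noethR pi (fin_gen_pair fgR G'_fg).
have noethA : left_noetherian (End_R_plus F')^c.
  exact (endo_left_noetherian noethR (fin_gen_pair fgR F'_fg)).
have res (X : complex (End_R_plus F')^c) : has_good_resolution c X.
  by apply: (@good_resolution _ _ c d) => M; apply: fg_projdim.
pose eF : End_R_plus F' := idem_R F'.
have ee : eF * eF = eF by apply: linearfun_ext.
(* Both idempotents project onto the same summand R, so e_A is carried to e_{A'}. Rewriting the goal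
   with this puts the generator of the target in the form [c eF] that the corner lemmas treat. *)
have ce : c eF = idem_R G'.
  by apply: linearfun_ext => x; congr (_, _); rewrite /= linear0.
have [f [f_inj f_sur]] := right_ideal_corner c ee.
rewrite /rel_sing_cat /eB -ce.
exists (verdier_map (resol_gen res (good_stalk _ (right_ideal_good c ee))
  (corner_stalk_quasi_iso (right_ideal_fg eF) (right_ideal_fg (c eF :
    End_R_plus G')) f_inj f_sur))).
exact: resol_verdier_fully_faithful.
Qed.
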